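(* Let $\mathcal{F}$ be a $p$-dimensional foliation of an $n$-dimensional differentiable manifold $M$, $q=n-p$, and let $TM=E\oplus T\mathcal{F}$ be a fixed decomposition. Let $h:\nu^*\mathcal{F}\to TM$ be a skew-symmetric vector bundle morphism, with local equations $$h(dx^a)=h^{ab}X_b+k^{au}\frac{\partial}{\partial y^u}$$ with respect to adapted local coordinates $(x^a,y^u)$, and let $W$ be the global cross section of $\wedge^2E$ (therefore, of $\wedge^2\nu\mathcal{F}$, where it is independent of the choice of $E$) with local components $h^{ab}$. Then $h$ is a hamiltonian structure of $\mathcal{F}$ if and only if the cross section $W$ is foliated and defines a structure of Poisson algebra on $\Omega^0_{\mathcal{F}}$.
   Context: Everything is of class $C^\infty$. $\nu\mathcal{F}=TM/T\mathcal{F}$ is the transversal bundle of $\mathcal{F}$, and its dual $\nu^*\mathcal{F}\subseteq T^*M$ is the annihilator of $T\mathcal{F}$. An object of $M$ that projects to the space of the leaves of $\mathcal{F}$ is called foliated, or projectable. $\Omega^k_{\mathcal{F}}$ is the space of projectable differential $k$-forms on $M$; in particular $\Omega^0_{\mathcal{F}}$ is the space of functions on $M$ that are constant along the leaves, and $\Omega^1_{\mathcal{F}}$ consists of global cross sections of $\nu^*\mathcal{F}$. $\chi(M)$ is the space of all vector fields on $M$, and $\chi_{\mathcal{F}}\subseteq\chi(M)$ is the Lie algebra of foliated vector fields (those $X$ such that $[X,Y]$ is tangent to $\mathcal{F}$ for every $Y$ tangent to $\mathcal{F}$). A cross section of $\wedge^2\nu\mathcal{F}$ is foliated if its components in adapted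 coordinates depend only on the $x^a$. The Gelfand-Dorfman complex of $(M,\mathcal{F})$ consists of the Lie algebra $\chi_{\mathcal{F}}$ and the complex $\bigoplus_{k=0}^q\Omega^k_{\mathcal{F}}$ with the usual exterior differential $d$ and contractions $i(X)$, $X\in\chi_{\mathcal{F}}$. A hamiltonian structure of this complex is a linear map $H:\Omega^1_{\mathcal{F}}\to\chi_{\mathcal{F}}$ which is skew symmetric, i.e. $\langle\alpha,H\beta\rangle=-\langle\beta,H\alpha\rangle$ for all $\alpha,\beta\in\Omega^1_{\mathcal{F}}$, and satisfies the Poisson condition $[H,H]=0$, where $$[H,H](\alpha,\beta,\gamma)=2\sum_{Cycl(\alpha,\beta,\gamma)}\langle H(L_{H\alpha}\beta),\gamma\rangle,\qquad \alpha,\beta,\gamma\in\Omega^1_{\mathcal{F}},$$ and $L_X=d\,i(X)+i(X)d$. A vector bundle morphism $h:\nu^*\mathcal{F}\to TM$ is skew symmetric if $\langle\alpha,h\beta\rangle=-\langle\beta,h\alpha\rangle$ for all $\alpha,\beta\in\nu^*_x\mathcal{F}$, $x\in M$. A hamiltonian structure of the foliation $\mathcal{F}$ is a vector bundle morphism $h:\nu^*\mathcal{F}\to TM$ such that the induced map of cross sections $H:\Omega^1_{\mathcal{F}}\to\chi(M)$ is a hamiltonian structure of the Gelfand-Dorfman complex of $(M,\mathcal{F})$; in particular, $h$ is skew symmetric pointwise and the values of $H$ are in $\chi_{\mathcal{F}}$. Adapted local coordinates are $(x^a,y^u)$, $a=1,\dots,q$, $u=q+1,\dots,n$, such that $x^a=\mathrm{const.}$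 are the local equations of $\mathcal{F}$. Then $E$ has the local basis $X_a=\frac{\partial}{\partial x^a}-t_a^u\frac{\partial}{\partial y^u}$ for some local coefficients $t_a^u$, $T\mathcal{F}$ is spanned by the $\frac{\partial}{\partial y^u}$, and $\nu^*\mathcal{F}$ is spanned by the $dx^a$. The summation convention is used. The bracket defined by $W$ on $\Omega^0_{\mathcal{F}}$ is $\{f,g\}=W(df,dg)$, locally $h^{ab}\frac{\partial f}{\partial x^a}\frac{\partial g}{\partial x^b}$; it defines a structure of Poisson algebra if it makes $\Omega^0_{\mathcal{F}}$ a Lie algebra and is a derivation in each argument.
   Formalization: Being hamiltonian and defining a Poisson algebra are required on every open subset U of M with the restricted foliation, not only for global projectable functions, forms and fields on M; with global objects only, both implications fail (Anosov suspension; SU(2)-Lie foliation with dense leaves). *)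

(* Defs.v *)
From HB Require Import structures.
From Stdlib Require Import Relation_Operators.
From mathcomp Require Import all_boot all_order all_algebra.
From mathcomp Require Import all_classical all_reals all_analysis.

Set Implicit Arguments.
Unset Strict Implicit.
Unset Printing Implicit Defensive.
Import Order.TTheory GRing.Theory Num.Theory numFieldNormedType.Exports.
Local Open Scope classical_set_scope.
Local Open Scope ring_scope.

(* Class C^k in the Frechet sense on an open set U: the coordinates of the
   differential of f are the directional derivatives 'D_v f. *)
Fixpoint Ck (R : realType) (n k : nat) (U : set 'rV[R]_n) (f : 'rV[R]_n -> R)
    : Prop :=
  if k is k'.+1 then
    (forall z, U z -> differentiable f z) /\ (forall v, Ck k' U ('D_v f))
  else forall z, U z -> {for z, continuous f}.

Definition smooth_on (R : realType) (n : nat) (U : set 'rV[R]_n)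
    (f : 'rV[R]_n -> R) : Prop :=
  forall k, Ck k U f.

(* Outside dom, resp. outside coord @` dom, the two maps are arbitrary. *)
Record chart (R : realType) (n : nat) (M : topologicalType) := Chart {
  dom : set M;
  coord : M -> 'rV[R]_n;
  param : 'rV[R]_n -> M;
  dom_open : open dom;
  img_open : open (coord @` dom);
  coordK : forall x, dom x -> param (coord x) = x;
  coord_continuous : forall x, dom x -> {for x, continuous coord};
  param_continuous : forall z, (coord @` dom) z -> {for z, continuous param} }.

Definition smooth_transition (R : realType) (n : nat) (M : topologicalType)
    (c c' : chart R n M) : Prop :=
  forall j, smooth_on (coord c @` (dom c `&` dom c'))
    (fun z => coord c' (param c z) 0 j).

Definition smooth_compatible (R : realType) (n : nat) (M : topologicalType)
    (c c' : chart R n M) : Prop :=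
  smooth_transition c c' /\ smooth_transition c' c.

Record manifold (R : realType) (n : nat) := Manifold {
  carrier :> topologicalType;
  carrier_hausdorff : hausdorff_space carrier;
  carrier_second_countable : @second_countable carrier;
  atlas : set (chart R n carrier);
  atlas_compatible : forall c c', atlas c -> atlas c' -> smooth_compatible c c';
  atlas_maximal : forall c,
    (forall c', atlas c' -> smooth_compatible c c') -> atlas c;
  chart_at : carrier -> chart R n carrier;
  chart_at_atlas : forall x, atlas (chart_at x);
  chart_at_dom : forall x, dom (chart_at x) x }.

(* The tangent space at x is identified with R^n (row vectors), and the
   cotangent space with its dual (column vectors), by means of the preferred
   chart chart_at x; components with respect to any other chart c are obtained
   with the Jacobian matrices of the changes of charts.  The choice of chart_at
   is immaterial, and it is not required to vary smoothly (or continuously)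
   with x: smoothness is always expressed with the components in a fixed
   chart. *)
Section Tensors.
Variables (R : realType) (n : nat) (M : manifold R n).
Implicit Types (c : chart R n M) (x : M) (U : set M).

Definition tangent (x : M) : Type := 'rV[R]_n.
Definition cotangent (x : M) : Type := 'cV[R]_n.
(* Bivectors, as skew-symmetric contravariant matrices. *)
Definition bivector (x : M) : Type := 'M[R]_n.
(* Covariant 2-tensors. *)
Definition cobivector (x : M) : Type := 'M[R]_n.

Definition transition_jac c c' x : 'M[R]_n :=
  jacobian (coord c' \o param c) (coord c x).

Definition vec_comp c x (v : tangent x) : 'rV[R]_n :=
  v *m transition_jac (chart_at x) c x.

Definition covec_comp c x (a : cotangent x) : 'cV[R]_n :=
  transition_jac c (chart_at x) x *m a.

(* The i-th coordinate vector of the chart c at x. *)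
Definition coord_vec c (i : 'I_n) x : tangent x :=
  row i (transition_jac c (chart_at x) x).

Definition pair x (a : cotangent x) (v : tangent x) : R := (v *m a) 0 0.

Definition wedge x (v w : tangent x) : bivector x := v^T *m w - w^T *m v.

(* (wedge v w)(a, b) = a(v) b(w) - a(w) b(v) *)
Definition bipair x (W : bivector x) (a b : cotangent x) : R :=
  (a^T *m W *m b) 0 0.

Definition vector_field := forall x : M, tangent x.
Definition one_form := forall x : M, cotangent x.
Definition bivector_field := forall x : M, bivector x.

Definition smooth_fun U (f : M -> R) : Prop :=
  forall c, atlas c -> smooth_on (coord c @` (U `&` dom c)) (f \o param c).

Definition smooth_vector_field U (X : vector_field) : Prop :=
  forall c, atlas c -> forall j, smooth_on (coord c @` (U `&` dom c))
    (fun z => vec_comp c (X (param c z)) 0 j).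

Definition smooth_one_form U (a : one_form) : Prop :=
  forall c, atlas c -> forall i, smooth_on (coord c @` (U `&` dom c))
    (fun z => covec_comp c (a (param c z)) i 0).

Definition dfun (f : M -> R) : one_form := fun x =>
  let c := chart_at x in
  \col_i 'D_(delta_mx 0 i) (f \o param c) (coord c x).

(* The i-th coordinate covector of the chart c at x. *)
Definition coord_covec c (i : 'I_n) : one_form := dfun (fun y => coord c y 0 i).

Definition dform (b : one_form) : forall x : M, cobivector x := fun x =>
  let c := chart_at x in
  let bc j := fun z => covec_comp c (b (param c z)) j 0 in
  \matrix_(i, j) ('D_(delta_mx 0 i) (bc j) (coord c x)
                  - 'D_(delta_mx 0 j) (bc i) (coord c x)).

Definition lie_derivative (X : vector_field) (b : one_form) : one_form :=
  fun x => dfun (fun y => pair (b y) (X y)) x + (X x *m dform b x)^T.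

Definition lie_bracket (X Y : vector_field) : vector_field := fun x =>
  let c := chart_at x in
  let Xc := fun z => vec_comp c (X (param c z)) in
  let Yc := fun z => vec_comp c (Y (param c z)) in
  let z := coord c x in
  \row_j ('D_(Xc z) (fun z => Yc z 0 j) z - 'D_(Yc z) (fun z => Xc z 0 j) z).

End Tensors.

Section Foliations.
Variables (R : realType) (q p : nat) (M : manifold R (q + p)).

(* The transverse coordinates x^a of a chart with coordinates (x^a, y^u). *)
Definition tcoord (c : chart R (q + p) M) (x : M) : 'rV[R]_q :=
  lsubmx (coord c x).

(* The image is a product of (necessarily open) intervals, so that the plaques
   x^a = const are connected. *)
Definition box_image (c : chart R (q + p) M) : Prop :=
  exists2 I : 'I_(q + p) -> set R, (forall i, is_interval (I i)) &
    coord c @` dom c = [set z | forall i, I i (z 0 i)].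

(* The change of coordinates is locally of the form x' = x'(x), y' = y'(x, y). *)
Definition transverse_change (c c' : chart R (q + p) M) : Prop :=
  forall x, dom c x -> dom c' x -> exists2 N : set M, nbhs x N &
    forall y z, N y -> N z -> tcoord c y = tcoord c z ->
      tcoord c' y = tcoord c' z.

(* A p-dimensional foliation, given by the maximal collection of its adapted
   charts. *)
Record foliation := Foliation {
  adapted : set (chart R (q + p) M);
  adapted_atlas : forall c, adapted c -> atlas c;
  adapted_box : forall c, adapted c -> box_image c;
  adapted_cover : forall x, exists2 c, adapted c & dom c x;
  adapted_compatible : forall c c', adapted c -> adapted c' ->
    transverse_change c c';
  adapted_maximal : forall c, atlas c -> box_image c ->
    (forall c', adapted c' ->
       transverse_change c c' /\ transverse_change c' c) ->
    adapted c }.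

Variable F : foliation.
Implicit Types (U : set M) (X : vector_field M) (a b : one_form M).

Definition in_TF (x : M) (v : tangent x) : Prop :=
  forall c, adapted F c -> dom c x -> lsubmx (vec_comp c v) = 0.

(* nu^*F, the annihilator of TF *)
Definition conormal (x : M) (a : cotangent x) : Prop :=
  forall v : tangent x, in_TF v -> pair a v = 0.

(* x and y lie on the same leaf of the restriction of F to the open set U:
   they are joined by a finite chain of plaques contained in U. *)
Definition plaque_in U (x y : M) : Prop :=
  exists c, [/\ adapted F c, dom c `<=` U, dom c x, dom c y &
    tcoord c x = tcoord c y].

Definition same_leaf U : M -> M -> Prop := clos_refl_sym_trans M (plaque_in U).

(* Omega^0_F, Omega^1_F and chi_F for the foliated manifold (U, F|U), U open
   in M.  The functions and tensor fields on U are represented by functions and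
   tensor fields on M, whose values outside U are irrelevant. *)
Definition foliated_fun U (f : M -> R) : Prop :=
  smooth_fun U f /\ forall x y, U x -> U y -> same_leaf U x y -> f x = f y.

(* Projectable 1-forms: a = a_a(x) dx^a in adapted coordinates. *)
Definition foliated_one_form U a : Prop :=
  smooth_one_form U a /\
  forall c, adapted F c -> dom c `<=` U ->
    exists g : 'I_q -> 'rV[R]_q -> R, forall x, dom c x ->
      a x = \sum_(i < q) g i (tcoord c x) *: coord_covec c (lshift p i) x.

Definition tangent_field U X : Prop :=
  smooth_vector_field U X /\ forall x, U x -> in_TF (X x).

Definition foliated_field U X : Prop :=
  smooth_vector_field U X /\
  forall Y, tangent_field U Y -> tangent_field U (lie_bracket X Y).

Definition schouten (H : one_form M -> vector_field M) a b (g : one_form M)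
    (x : M) : R :=
  2 * (pair (g x) (H (lie_derivative (H a) b) x)
     + pair (a x) (H (lie_derivative (H b) g) x)
     + pair (b x) (H (lie_derivative (H g) a) x)).

(* Hamiltonian structures of the Gelfand-Dorfman complex of (U, F|U).  The
   first conjunct says that H acts on 1-forms defined on U only. *)
Definition GD_hamiltonian U (H : one_form M -> vector_field M) : Prop :=
  [/\ forall a b, foliated_one_form U a -> foliated_one_form U b ->
        (forall x, U x -> a x = b x) -> forall x, U x -> H a x = H b x,
      forall a, foliated_one_form U a -> foliated_field U (H a),
      forall (r : R) a b, foliated_one_form U a -> foliated_one_form U b ->
        forall x, U x ->
          H (fun y => r *: a y + b y) x = r *: H a x + H b x,
      forall a b, foliated_one_form U a -> foliated_one_form U b ->
        forall x, U x -> pair (a x) (H b x) = - pair (b x) (H a x) &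
      forall a b g, foliated_one_form U a -> foliated_one_form U b ->
        foliated_one_form U g -> forall x, U x -> schouten H a b g x = 0].

(* A fibrewise map T^*M -> TM stands for a map nu^*F -> TM: its values outside
   nu^*F are irrelevant. *)
Definition fibre_map := forall x : M, cotangent x -> tangent x.

Implicit Type h : fibre_map.

Definition bundle_morphism h : Prop :=
  (forall (x : M) (r : R) (a b : cotangent x), conormal a -> conormal b ->
     h x (r *: a + b) = r *: h x a + h x b) /\
  (forall U a, open U -> smooth_one_form U a ->
     (forall x, U x -> conormal (a x)) ->
     smooth_vector_field U (fun x => h x (a x))).

Definition skew_symmetric h : Prop :=
  forall (x : M) (a b : cotangent x), conormal a -> conormal b ->
    pair a (h x b) = - pair b (h x a).

(* Projectable objects are taken as (pre)sheaves: the conditions are imposed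
   on (U, F|U) for every open U, in particular for U = M.  On M alone there may
   be too few of them: Omega^1_F may vanish, and Omega^0_F may reduce to the
   constants. *)
Definition hamiltonian_structure h : Prop :=
  bundle_morphism h /\
  forall U, open U -> GD_hamiltonian U (fun a x => h x (a x)).

(* Smooth vector subbundles of TM complementary to TF. *)
Definition complement (E : forall x : M, {vspace 'rV[R]_(q + p)}) : Prop :=
  (forall (x : M) (v : tangent x),
     exists! e : tangent x, e \in E x /\ @in_TF x (v - e)) /\
  (forall x0 : M, exists2 U, open U /\ U x0 &
     exists2 Z : 'I_q -> vector_field M,
       (forall i, smooth_vector_field U (Z i)) &
       forall x, U x -> E x = <<[seq (Z i x : 'rV[R]_(q + p)) | i : 'I_q]>>%VS).

(* The vectors X_a of E, for the coefficients t_a^u. *)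
Definition frame_vec (c : chart R (q + p) M) (t : 'M[R]_(q, p)) (i : 'I_q)
    (x : M) : tangent x :=
  coord_vec c (lshift p i) x - \sum_(u < p) t i u *: coord_vec c (rshift q u) x.

(* W is foliated, as a section of wedge^2 nuF. *)
Definition foliated_bivector (W : bivector_field M) : Prop :=
  forall c, adapted F c -> exists w : 'rV[R]_q -> 'M[R]_q,
    forall x, dom c x -> forall i j : 'I_q,
      bipair (W x) (coord_covec c (lshift p i) x) (coord_covec c (lshift p j) x)
      = w (tcoord c x) i j.

Definition bracket (W : bivector_field M) (f g : M -> R) : M -> R :=
  fun x => bipair (W x) (dfun f x) (dfun g x).

Definition poisson_algebra U (br : (M -> R) -> (M -> R) -> M -> R) : Prop :=
  forall f g k, foliated_fun U f -> foliated_fun U g -> foliated_fun U k ->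
  foliated_fun U (br f g) /\
  forall x, U x ->
  [/\ forall r : R, br (fun y => r * f y + g y) k x = r * br f k x + br g k x,
      forall r : R, br k (fun y => r * f y + g y) x = r * br k f x + br k g x,
      br f f x = 0,
      br (br f g) k x + br (br g k) f x + br (br k f) g x = 0 &
      br (fun y => f y * g y) k x = f x * br g k x + br f k x * g x /\
      br k (fun y => f y * g y) x = f x * br k g x + br k f x * g x].

Definition defines_poisson_algebra (W : bivector_field M) : Prop :=
  forall U, open U -> poisson_algebra U (bracket W).

End Foliations.

(* Main.v *)
(* The hamiltonian condition on h and the Poisson condition on W are linked by
   {f, g} = <dg, h(df)>, valid whenever df and dg are conormal, because the
   vertical part of h is killed by conormal covectors.  For a tangent field Y
   and X = H(df), Yg = 0 gives [X, Y]g = - Y(Xg) = - Y{f, g}: hence H(df) is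
   foliated exactly when the brackets {f, g} are constant along the leaves.
   Evaluated on exact forms, [H, H] is twice the Jacobi sum; conversely, in
   adapted coordinates the terms of [H, H] that differentiate the coefficients
   of the forms cancel in the cyclic sum by skew symmetry, and what remains is
   the Jacobi sum of the coordinates x^a. *)
From mathcomp Require Import all_boot all_order all_algebra.
From mathcomp Require Import all_classical all_reals all_analysis.
From mathcomp Require Import ring lra.
(* Required last: Defs.coord has to shadow vector.coord. *)
Require Import Defs.
Set Implicit Arguments.
Unset Strict Implicit.
Unset Printing Implicit Defensive.
Import Order.TTheory GRing.Theory Num.Theory numFieldNormedType.Exports.
Local Open Scope classical_set_scope.
Local Open Scope ring_scope.

(** * Differential calculus on R^n *)

Section Differentials.
Context {R : realType}.
Implicit Types V W : normedModType R.

(** The tangent space at [x] is trivialised by a chart depending arbitrarily on [x], so fields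
    cannot be differentiated in that trivialisation. Computations are expressed with pairings
    instead: components of a vector are values of coordinate differentials, df(v) is a directional
    derivative in any chart, a Lie bracket is known by its action on functions, and forms are
    written as sums of f dg. The one second-order fact behind all this is the symmetry of second
    derivatives. Constancy along leaves becomes a pointwise condition, a conormal differential; the
    way back integrates along segments of plaques, where the box images of adapted charts serve.
    Projectable objects may be scarce on M, so the argument runs over the domain of a small adapted
    chart, where the functions x^a and the vertical coordinate fields are available as test objects.
    An iterated bracket can be expressed with [h] only once brackets of foliated functions are known
    to be foliated; hence this precedes the Jacobi identity. *)

Lemma near_eq_differentiable V W (f g : V -> W) x :
  (\near x, f x = g x) -> differentiable f x -> differentiable g x.
Proof.
move=> fg df.
(* The differential of [f] gives a first-order expansion of [g] too; by uniqueness it is the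
   differential of [g]. *)
have gE : g \o shift x = cst (g x) + 'd f x +o_ 0 id.
  apply/eqaddoP => _/posnumP[e].
  have /diff_locally/eqaddoP/(_ _ (gt0 e)) := df.
  have fg0 : \forall y \near 0, f (y + x) = g (y + x).
    by move: fg; rewrite [in X in X -> _](near_shift 0) subr0.
  apply: filter_app; near=> y => /=.
  rewrite !fctE /= (near fg0 y) //.
  by rewrite (nbhs_singleton fg).
apply/diff_locallyP; split.
  by rewrite (diff_unique (diff_continuous df) gE); exact: diff_continuous.
by rewrite (diff_unique (diff_continuous df) gE).
Unshelve. all: by end_near. Qed.

Lemma differentiable_rV V n (f : V -> 'rV[R]_n) x :
  (forall j, differentiable (fun z => f z 0 j) x) -> differentiable f x.
Proof.
move=> df.
have -> : f = \sum_(j < n) (fun z => f z 0 j *: (delta_mx 0 j : 'rV[R]_n)).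
  by apply/funext => z; rewrite fct_sumE [LHS]row_sum_delta.
by apply: differentiable_sum => j; exact: differentiableZl.
Qed.

Lemma derive_deltaE n (f : 'rV[R]_n -> R) z v : differentiable f z ->
  'D_v f z = \sum_(j < n) v 0 j * 'D_(delta_mx 0 j) f z.
Proof.
move=> df; rewrite deriveE // {1}(row_sum_delta v) linear_sum.
by apply: eq_bigr => j _; rewrite linearZ deriveE.
Qed.

Lemma derive_comp V1 V2 V3 (f : V2 -> V3) (g : V1 -> V2) z v :
  differentiable g z -> differentiable f (g z) ->
  'D_v (f \o g) z = 'D_('D_v g z) f (g z).
Proof.
move=> dg df; rewrite deriveE; last exact: differentiable_comp.
by rewrite diff_comp //= deriveE // deriveE.
Qed.

Lemma derive_rVE m n (g : 'rV[R]_m -> 'rV[R]_n) z v j :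
  differentiable g z -> ('D_v g z) 0 j = 'D_v (fun y => g y 0 j) z.
Proof. by move=> dg; rewrite derive_mx ?mxE //; exact: diff_derivable. Qed.

Lemma derive_add V (f g : V -> R) z v :
  differentiable f z -> differentiable g z ->
  'D_v (fun y => f y + g y) z = 'D_v f z + 'D_v g z.
Proof. by move=> df dg; rewrite deriveD //; exact: diff_derivable. Qed.

Lemma derive_mul V (f g : V -> R) z v :
  differentiable f z -> differentiable g z ->
  'D_v (fun y => f y * g y) z = 'D_v f z * g z + f z * 'D_v g z.
Proof.
move=> df dg; rewrite deriveM; try exact: diff_derivable.
by rewrite addrC [g z *: _]mulrC.
Qed.

Lemma derive_bigsum V n (f : 'I_n -> V -> R) z v :
  (forall i, differentiable (f i) z) ->
  'D_v (fun y => \sum_(i < n) f i y) z = \sum_(i < n) 'D_v (f i) z.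
Proof.
move=> df; rewrite -derive_sum; last by move=> i; exact: diff_derivable.
by congr ('D_v _ z); apply/funext => y; rewrite fct_sumE.
Qed.

Lemma is_derive_line V (f : V -> R) p w (t : R) :
  derivable f (p + t *: w) w ->
  is_derive t 1 (fun s : R => f (p + s *: w)) ('D_w f (p + t *: w)).
Proof.
have E : (fun h : R => h^-1 *: (((fun s : R => f (p + s *: w)) \o shift t)
    (h *: 1) - f (p + t *: w))) =
  (fun h : R => h^-1 *: ((f \o shift (p + t *: w)) (h *: w) - f (p + t *: w))).
  apply/funext => h /=; congr (_ *: (f _ - _)).
  by rewrite [_%:A]mulr1 scalerDl addrCA.
by move=> df; apply: DeriveDef; rewrite /derivable /derive E.
Qed.

Lemma MVT_line V (f : V -> R) p w (s : R) : 0 <= s ->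
  (forall t : R, 0 <= t <= s -> derivable f (p + t *: w) w) ->
  exists2 t : R, 0 <= t <= s & f (p + s *: w) - f p = s * 'D_w f (p + t *: w).
Proof.
move=> s0 df.
pose g (r : R) := f (p + r *: w); pose dg (r : R) := 'D_w f (p + r *: w).
have dline (t : R) : t \in `[0, s]%R -> is_derive t 1 g (dg t).
  by rewrite in_itv /= => ts; exact/is_derive_line/df.
have cg : {within `[0, s], continuous g}.
  by apply: derivable_within_continuous => t ts; have [] := dline _ ts.
have dline' (t : R) : t \in `]0, s[%R -> is_derive t 1 g (dg t).
  by move=> /subset_itv_oo_cc ts; exact: dline.
have [t ts] := MVT_segment s0 dline' cg; rewrite /g /dg.
rewrite scale0r addr0 subr0 => E; exists t; last by rewrite E mulrC.
by rewrite in_itv /= in ts.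
Qed.

Lemma derivable_shift V (f : V -> R) a z u :
  derivable f (z + a) u -> derivable (fun y => f (y + a)) z u.
Proof.
rewrite /derivable; set g1 := fun h => _; set g2 := fun h => _.
by suff -> : g1 = g2 by []; apply/funext => h; rewrite /g1 /g2 /= addrA.
Qed.

Lemma derive_shiftE V (f : V -> R) a z u :
  'D_u (fun y => f (y + a)) z = 'D_u f (z + a).
Proof.
rewrite /derive; set g1 := fun h => _; set g2 := fun h => _.
by suff -> : g1 = g2 by []; apply/funext => h; rewrite /g1 /g2 /= addrA.
Qed.

(** The mean value theorem is used twice: along [u] for the increment of [f] in direction [v], then
    along [v] for ['D_u f]. Both points lie in the closed parallelogram spanned by [s *: u] and
    [s *: v]. *)
Lemma second_difference V (f : V -> R) z u v (s : R) : 0 <= s ->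
  (forall a b : R, 0 <= a <= s -> 0 <= b <= s ->
     differentiable f (z + a *: u + b *: v) /\
     differentiable ('D_u f) (z + a *: u + b *: v)) ->
  exists a b : R, [/\ 0 <= a <= s, 0 <= b <= s &
    f (z + s *: u + s *: v) - f (z + s *: u) - (f (z + s *: v) - f z) =
    s * (s * 'D_v ('D_u f) (z + a *: u + b *: v))].
Proof.
move=> s0 df.
have l0 : 0 <= (0 : R) <= s by rewrite lexx.
have ls : 0 <= s <= s by rewrite lexx s0.
pose g y := f (y + s *: v) - f y.
have dg t : 0 <= t <= s ->
    derivable (fun y => f (y + s *: v)) (z + t *: u) u /\
    derivable f (z + t *: u) u.
  move=> ts; split.
    by apply: derivable_shift; apply: diff_derivable; have [] := df _ _ ts ls.
  have [+ _] := df _ _ ts l0; rewrite scale0r addr0 => ?.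
  exact: diff_derivable.
have [|a as_ Ea] := @MVT_line V g z u s s0.
  move=> t /dg[d1 d2].
  exact: (@derivableB _ _ _ (fun y => f (y + s *: v)) f _ _ d1 d2).
have [|b bs Eb] := @MVT_line V ('D_u f) (z + a *: u) v s s0.
  by move=> t ts; apply: diff_derivable; have [] := df _ _ as_ ts.
exists a, b; split => //.
rewrite -Eb; move: Ea; rewrite /g => ->; congr (_ * _).
have [d1 d2] := dg _ as_.
by have := deriveB d1 d2; rewrite derive_shiftE; apply.
Qed.

(** The second difference over a small parallelogram is symmetric in [u] and [v], and equals s^2
    times either mixed derivative, each at some point near [z]. Continuity at [z] then bounds the
    discrepancy by any e > 0. *)
Lemma schwarz V (U : set V) (f : V -> R) z u v : open U -> U z ->
  (forall y, U y -> [/\ differentiable f y, differentiable ('D_u f) y &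
     differentiable ('D_v f) y]) ->
  {for z, continuous ('D_v ('D_u f))} -> {for z, continuous ('D_u ('D_v f))} ->
  'D_v ('D_u f) z = 'D_u ('D_v f) z.
Proof.
move=> oU Uz df cvu cuv.
apply/eqP; rewrite -subr_eq0 -normr_eq0; apply/eqP.
apply/eqP; rewrite eq_le normr_ge0 andbT; apply/ler_addgt0Pr => e e0;
  rewrite add0r.
have e20 : 0 < e / 2 by rewrite divr_gt0.
have [d /= d0 Bd] := (nbhs_ballP _ _).1 (filterI (open_nbhs_nbhs (conj oU Uz))
  (filterI ((cvgrPdist_lt _ _).1 cvu _ e20) ((cvgrPdist_lt _ _).1 cuv _ e20))).
(* [m] exceeds |u| + |v|, and the 1 keeps it positive when both vectors vanish; with s = d / (2m)
   the parallelogram stays within d / 2 of [z]. *)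
pose m := `|u| + `|v| + 1.
have m0 : 0 < m by apply: ltr_wpDl => //; apply: addr_ge0.
pose s := d / (m * 2).
have s0 : 0 < s by rewrite divr_gt0 // mulr_gt0.
have near_sq (a b : R) : 0 <= a <= s -> 0 <= b <= s -> ball z d (z + a *: u + b
  *: v).
  move=> /andP[a0 as_] /andP[b0 bs].
  rewrite -ball_normE /ball_ /= -addrA opprD addrA subrr add0r normrN.
  apply: (@le_lt_trans _ _ (s * `|u| + s * `|v|)).
    rewrite (le_trans (ler_normD _ _)) // !normrZ !ger0_norm //.
    by rewrite lerD // ler_wpM2r.
  rewrite -mulrDr (@lt_le_trans _ _ (s * m)) // ?ltr_pM2l // ?ltrDl //.
  have -> : s * m = d / 2 by rewrite /s; field; rewrite gt_eqF.
  by rewrite ler_pdivrMr // ler_peMr ?ltW ?ltr1n.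
have [|a [b [as_ bs E1]]] := @second_difference V f z u v s (ltW s0).
  by move=> a b as_ bs; have [/df[] ] := Bd _ (near_sq _ _ as_ bs).
have [|b' [a' [bs' as' E2]]] := @second_difference V f z v u s (ltW s0).
  move=> x y xs ys; rewrite addrAC.
  by have [/df[] ] := Bd _ (near_sq _ _ ys xs).
(* Both sides times s^2 are the same second difference; the two factors s are cancelled. *)
have E : 'D_v ('D_u f) (z + a *: u + b *: v) = 'D_u ('D_v f) (z + b' *: v + a'
  *: u).
  apply: (mulfI (lt0r_neq0 s0)); apply: (mulfI (lt0r_neq0 s0)).
  rewrite [z + s *: v + s *: u]addrAC in E2.
  by apply: (etrans (esym E1)); apply: (etrans _ E2); ring.
have [_ [/= H1 _]] := Bd _ (near_sq _ _ as_ bs).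
have [_ [_ /= H2]] := Bd _ (near_sq _ _ as' bs').
rewrite addrAC -E in H2.
rewrite -(subrKA ('D_v ('D_u f) (z + a *: u + b *: v))).
apply: (le_trans (ler_normD _ _)); rewrite (splitr e).
by rewrite [X in _ + X]distrC; exact: lerD (ltW H1) (ltW H2).
Qed.

End Differentials.

(** * Functions of class C^k *)

Section SmoothFunctions.
Context {R : realType} {n : nat}.
Implicit Types (U V : set 'rV[R]_n) (f g : 'rV[R]_n -> R).

Lemma Ck_mono k U V f : V `<=` U -> Ck k U f -> Ck k V f.
Proof.
move=> VU; elim: k f => [|k IH] f /=; first by move=> cf z /VU; exact: cf.
by move=> [df Df]; split=> [z /VU/df//|v]; exact: IH.
Qed.

Lemma Ck_eq k U f g : open U -> (forall z, U z -> f z = g z) ->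
  Ck k U f -> Ck k U g.
Proof.
move=> oU; elim: k f g => [|k IH] f g fg /=.
  move=> cf z Uz; have fgz : \near z, f z = g z.
    by apply: filterS (open_nbhs_nbhs (conj oU Uz)) => y; exact: fg.
  rewrite /prop_for /continuous_at -(fg _ Uz).
  have := cf _ Uz; rewrite /prop_for /continuous_at; apply: cvg_trans.
  by move=> A; apply: filterS2 fgz => y /= ->.
have fgz z : U z -> \near z, f z = g z.
  by move=> Uz; apply: filterS (open_nbhs_nbhs (conj oU Uz)) => y; exact: fg.
move=> [df Df]; split=> [z Uz|v].
  exact: (near_eq_differentiable (fgz _ Uz) (df _ Uz)).
apply: IH (Df v) => z Uz; exact/near_eq_derive/fgz.
Qed.

Lemma CkW k U f : Ck k.+1 U f -> Ck k U f.
Proof.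
elim: k f => [|k IH] f [df Df]; first by move=> z /df;
  exact: differentiable_continuous.
by split=> // v; exact: IH.
Qed.

Lemma Ck_cst k U (a : R) : Ck k U (fun=> a).
Proof.
elim: k a => [|k IH] a /=; first by move=> z _; exact: cst_continuous.
split=> [z _|v]; first exact: differentiable_cst.
rewrite (_ : 'D_v _ = fun=> 0) //; apply/funext => z.
exact: derive_cst.
Qed.

Lemma CkD k U f g : open U -> Ck k U f -> Ck k U g ->
  Ck k U (fun z => f z + g z).
Proof.
move=> oU; elim: k f g => [|k IH] f g /=.
  by move=> cf cg z Uz; apply: continuousD; [exact: cf|exact: cg].
move=> [df Df] [dg Dg]; split=> [z Uz|v].
  exact: differentiableD (df _ Uz) (dg _ Uz).
apply: Ck_eq (IH _ _ (Df v) (Dg v)) => // z Uz.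
by rewrite derive_add //; [exact: df|exact: dg].
Qed.

Lemma CkM k U f g : open U -> Ck k U f -> Ck k U g ->
  Ck k U (fun z => f z * g z).
Proof.
move=> oU; elim: k f g => [|k IH] f g.
  by move=> /= cf cg z Uz; apply: continuousM; [exact: cf|exact: cg].
move=> cf cg; have [cf' cg'] := (CkW cf, CkW cg).
case: cf cg => [df Df] [dg Dg]; split=> [z Uz|v].
  exact: differentiableM (df _ Uz) (dg _ Uz).
apply: (@Ck_eq _ _ (fun z => 'D_v f z * g z + f z * 'D_v g z)) => //.
  by move=> z Uz; rewrite derive_mul //; [exact: df|exact: dg].
by apply: CkD => //; apply: IH => //; [exact: Df|exact: Dg].
Qed.

Lemma Ck_sum k U m (f : 'I_m -> 'rV[R]_n -> R) : open U ->
  (forall i, Ck k U (f i)) -> Ck k U (fun z => \sum_(i < m) f i z).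
Proof.
move=> oU cf; have -> : (fun z => \sum_(i < m) f i z) = \sum_(i < m) f i.
  by apply/funext => z; rewrite fct_sumE.
by elim/big_ind : _ => [|g h|i _]; [exact: Ck_cst|exact: CkD|exact: cf].
Qed.

End SmoothFunctions.

(** The class lost pays for the continuity of the vector-valued [g], deduced from the
    differentiability of its components even when k = 0. The induction differentiates by the chain
    rule. For smooth functions the loss is immaterial. *)
Lemma Ck_comp (R : realType) m n k (U : set 'rV[R]_m) (V : set 'rV[R]_n)
    (f : 'rV[R]_n -> R) (g : 'rV[R]_m -> 'rV[R]_n) : open U ->
  (forall z, U z -> V (g z)) -> Ck k.+1 V f ->
  (forall j, Ck k.+1 U (fun z => g z 0 j)) -> Ck k U (f \o g).
Proof.
move=> oU UV + cg.
have dg z : U z -> differentiable g z.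
  by move=> Uz; apply: differentiable_rV => j; have [/(_ _ Uz)] := cg j.
elim: k cg f => [|k IH] cg f [df Df].
  move=> z Uz; apply: continuous_comp; apply: differentiable_continuous.
    exact: dg.
  exact/df/UV.
split=> [z Uz|v]; first by apply: differentiable_comp; [exact: dg|exact/df/UV].
apply: (@Ck_eq _ _ _ _ (fun z => \sum_(j < n)
  'D_v (fun y => g y 0 j) z * ('D_(delta_mx 0 j) f \o g) z)) => //.
  move=> z Uz; rewrite derive_comp ?derive_deltaE //; last 3 first.
  - exact/df/UV.
  - exact: dg.
  - exact/df/UV.
  by apply: eq_bigr => j _; rewrite derive_rVE //; exact: dg.
apply: Ck_sum => // j; apply: CkM => //; first by have [_ /(_ v)/CkW] := cg j.
by apply: IH => [i|]; [exact: CkW|exact: Df].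
Qed.

Section Smooth.
Context {R : realType} {n : nat}.
Implicit Types (U V : set 'rV[R]_n) (f g : 'rV[R]_n -> R).

Lemma smooth_on_mono U V f : V `<=` U -> smooth_on U f -> smooth_on V f.
Proof. by move=> VU sf k; exact: Ck_mono (sf k). Qed.

Lemma smooth_on_eq U f g : open U -> (forall z, U z -> f z = g z) ->
  smooth_on U f -> smooth_on U g.
Proof. by move=> oU fg sf k; exact: Ck_eq (sf k). Qed.

Lemma smooth_onD U f g : open U -> smooth_on U f -> smooth_on U g ->
  smooth_on U (fun z => f z + g z).
Proof. by move=> oU sf sg k; exact: CkD. Qed.

Lemma smooth_onM U f g : open U -> smooth_on U f -> smooth_on U g ->
  smooth_on U (fun z => f z * g z).
Proof. by move=> oU sf sg k; exact: CkM. Qed.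

Lemma smooth_on_cst U (a : R) : smooth_on U (fun=> a).
Proof. by move=> k; exact: Ck_cst. Qed.

Lemma smooth_on_sum U m (f : 'I_m -> 'rV[R]_n -> R) : open U ->
  (forall i, smooth_on U (f i)) -> smooth_on U (fun z => \sum_(i < m) f i z).
Proof. by move=> oU sf k; apply: Ck_sum => // i; exact: sf. Qed.

Lemma smooth_on_differentiable U f z : smooth_on U f -> U z ->
  differentiable f z.
Proof. by move=> /(_ 1)[df _]; exact: df. Qed.

Lemma smooth_on_derive U f (v : 'rV[R]_n) :
  smooth_on U f -> smooth_on U ('D_v f).
Proof. by move=> sf k; have [_ /(_ v)] := sf k.+1. Qed.

Lemma smooth_on_comp m U (V : set 'rV[R]_m) (f : 'rV[R]_m -> R)
    (g : 'rV[R]_n -> 'rV[R]_m) : open U -> (forall z, U z -> V (g z)) ->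
  smooth_on V f -> (forall j, smooth_on U (fun z => g z 0 j)) ->
  smooth_on U (f \o g).
Proof. by move=> oU UV sf sg k; apply: Ck_comp UV (sf _) _ => // j;
  exact: sg. Qed.

Lemma smooth_on_deriveC U f z u v : open U -> U z -> smooth_on U f ->
  'D_v ('D_u f) z = 'D_u ('D_v f) z.
Proof.
move=> oU Uz sf; apply: (schwarz oU Uz) => [y Uy||].
- by split; apply: (smooth_on_differentiable _ Uy) => //;
  exact: smooth_on_derive.
- have := @smooth_on_derive _ _ v (@smooth_on_derive _ _ u sf) 0%N z Uz.
  exact.
- have := @smooth_on_derive _ _ u (@smooth_on_derive _ _ v sf) 0%N z Uz.
  exact.
Qed.

End Smooth.

(** * Tensor calculus in charts *)

Section Pairing.
Context {R : realType} {n : nat} {M : manifold R n}.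
Implicit Types (c : chart R n M) (x : M).

Lemma pairDl x (a b : cotangent x) (v : tangent x) :
  pair (x := x) (a + b) v = pair a v + pair b v.
Proof. by rewrite /pair mulmxDr mxE. Qed.

Lemma pairZl x (r : R) (a : cotangent x) (v : tangent x) :
  pair (x := x) (r *: a) v = r * pair a v.
Proof. by rewrite /pair -scalemxAr mxE. Qed.

Lemma pairDr x (a : cotangent x) (v w : tangent x) :
  pair (x := x) a (v + w) = pair a v + pair a w.
Proof. by rewrite /pair mulmxDl mxE. Qed.

Lemma pairZr x (r : R) (a : cotangent x) (v : tangent x) :
  pair (x := x) a (r *: v) = r * pair a v.
Proof. by rewrite /pair -scalemxAl mxE. Qed.

Lemma pair_suml x m (a : 'I_m -> cotangent x) (v : tangent x) :
  pair (x := x) (\sum_(i < m) a i) v = \sum_(i < m) pair (a i) v.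
Proof. by rewrite /pair mulmx_sumr summxE. Qed.

Lemma pair_sumr x m (a : cotangent x) (v : 'I_m -> tangent x) :
  pair (x := x) a (\sum_(i < m) v i) = \sum_(i < m) pair a (v i).
Proof. by rewrite /pair mulmx_suml summxE. Qed.

Lemma pair_ext x (a b : cotangent x) :
  (forall v : tangent x, pair a v = pair b v) -> a = b.
Proof.
move=> ab; apply/colP => i; have := ab (delta_mx 0 i).
by rewrite /pair -!rowE !mxE.
Qed.

End Pairing.

Section Charts.
Context {R : realType} {n : nat} {M : manifold R n}.
Implicit Types (c : chart R n M) (x : M) (U V : set M).

Lemma paramK c z : (coord c @` dom c) z -> coord c (param c z) = z.
Proof. by move=> [x cx <-]; rewrite coordK. Qed.

Lemma near_param c x (P : set M) : dom c x -> nbhs x P ->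
  \forall z \near coord c x, P (param c z).
Proof.
move=> cx Px; have := @param_continuous _ _ _ c (coord c x) (imageP _ cx).
by rewrite /prop_for /continuous_at coordK //; apply.
Qed.

Lemma open_coord c U : open U -> open (coord c @` (U `&` dom c)).
Proof.
move=> oU; rewrite openE => _ [x [Ux cx] <-]; rewrite /interior.
have H1 : nbhs (coord c x) (coord c @` dom c).
  by apply: open_nbhs_nbhs; split; [exact: img_open|exact: imageP].
apply: filterS2 H1 (near_param cx (open_nbhs_nbhs (conj oU Ux))).
by move=> _ [y cy <-]; rewrite coordK // => Uy; exists y.
Qed.

Lemma coord_image c U z : (coord c @` (U `&` dom c)) z ->
  [/\ U (param c z), dom c (param c z) & coord c (param c z) = z].
Proof. by move=> [x [Ux cx] <-]; rewrite coordK. Qed.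

Lemma nbhs_coord c U x : open U -> U x -> dom c x ->
  nbhs (coord c x) (coord c @` (U `&` dom c)).
Proof.
move=> oU Ux cx; apply: open_nbhs_nbhs; split; first exact: open_coord.
by exists x.
Qed.

Lemma transition_smooth c c' U j : atlas c -> atlas c' -> U `<=` dom c' ->
  smooth_on (coord c @` (U `&` dom c)) (fun z => coord c' (param c z) 0 j).
Proof.
move=> ac ac' Uc'; apply: smooth_on_mono (proj1 (atlas_compatible ac ac') j).
by move=> _ [x [/Uc' c'x cx] <-]; exists x.
Qed.

Lemma transition_differentiable c c' x : atlas c -> atlas c' ->
  dom c x -> dom c' x -> differentiable (coord c' \o param c) (coord c x).
Proof.
move=> ac ac' cx c'x; apply: differentiable_rV => j.
apply: (smooth_on_differentiable (transition_smooth j ac ac' (@subset_refl _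
  _))).
by exists x.
Qed.

(** Only a local identity: [param c'] inverts [coord c'] on [dom c'], a neighbourhood of [x]. *)
Lemma near_transition (T : Type) c c' x (f : M -> T) : dom c x -> dom c' x ->
  \forall z \near coord c x,
    (f \o param c) z = ((f \o param c') \o (coord c' \o param c)) z.
Proof.
move=> cx c'x; have := near_param cx (open_nbhs_nbhs (conj (@dom_open _ _ _ c')
  c'x)).
by apply: filterS => z c'z /=; rewrite coordK.
Qed.

Lemma derive_chart (W : normedModType R) c c' x (f : M -> W) v :
  atlas c -> atlas c' -> dom c x -> dom c' x ->
  differentiable (f \o param c') (coord c' x) ->
  'D_v (f \o param c) (coord c x) =
  'D_(v *m transition_jac c c' x) (f \o param c') (coord c' x).
Proof.
move=> ac ac' cx c'x df; have dt := transition_differentiable ac ac' cx c'x.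
rewrite (near_eq_derive v (near_transition f cx c'x)).
rewrite derive_comp //=; last by rewrite coordK.
by rewrite (deriveEjacobian v dt) coordK.
Qed.

(** [derive_chart] for the coordinate map of [c''], tested on all row vectors. *)
Lemma transition_jac_comp c c' c'' x : atlas c -> atlas c' -> atlas c'' ->
  dom c x -> dom c' x -> dom c'' x ->
  transition_jac c c' x *m transition_jac c' c'' x = transition_jac c c'' x.
Proof.
move=> ac ac' ac'' cx c'x c''x.
have d := transition_differentiable ac' ac'' c'x c''x.
have d' := transition_differentiable ac ac'' cx c''x.
have E (v : 'rV_n) : v *m transition_jac c c' x *m transition_jac c' c'' x =
           v *m transition_jac c c'' x.
  rewrite -[RHS](deriveEjacobian v d') (derive_chart v ac ac' cx c'x d).
  by rewrite -[LHS](deriveEjacobian _ d).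
by apply/row_matrixP => i; rewrite (rowE i (transition_jac c c'' x)) -E
  -mulmxA -rowE.
Qed.

Lemma transition_jac_id c x : atlas c -> dom c x -> transition_jac c c x = 1%:M.
Proof.
move=> ac cx; apply/row_matrixP => i; rewrite !rowE mulmx1.
rewrite -deriveEjacobian; last exact: transition_differentiable.
have idE : \forall z \near coord c x, (coord c \o param c) z = id z.
  have : nbhs (coord c x) (coord c @` dom c).
    by apply: open_nbhs_nbhs; split; [exact: img_open|exact: imageP].
  by apply: filterS => z /paramK.
by rewrite (near_eq_derive _ idE) derive_id.
Qed.

Lemma vec_comp_chart_at x (v : tangent x) : vec_comp (chart_at x) v = v.
Proof.
rewrite /vec_comp transition_jac_id ?mulmx1 //; first exact: chart_at_atlas.
exact: chart_at_dom.
Qed.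

Lemma vec_comp_coord_vec c c' x i : atlas c -> atlas c' -> dom c x ->
  dom c' x -> vec_comp c' (coord_vec c i x) = row i (transition_jac c c' x).
Proof.
move=> ac ac' cx c'x; rewrite /vec_comp /coord_vec -row_mul transition_jac_comp
  //.
  exact: chart_at_atlas.
exact: chart_at_dom.
Qed.

(** Invariance of the pairing: the Jacobian matrices of the two changes of charts are inverse to
    each other. *)
Lemma pair_comp c x (a : cotangent x) (v : tangent x) : atlas c -> dom c x ->
  pair a v = \sum_(i < n) vec_comp c v 0 i * covec_comp c a i 0.
Proof.
move=> ac cx; have a0 := chart_at_atlas x; have x0 := chart_at_dom x.
transitivity ((vec_comp c v *m covec_comp c a) 0 0); last by rewrite mxE.
rewrite /vec_comp /covec_comp mulmxA -(mulmxA v) transition_jac_comp //.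
by rewrite transition_jac_id // mulmx1.
Qed.

Lemma covec_comp_pair c x (a : cotangent x) i :
  covec_comp c a i 0 = pair a (coord_vec c i x).
Proof.
rewrite /covec_comp /pair /coord_vec mxE [RHS]mxE.
by apply: eq_bigr => j _; rewrite [in RHS]mxE.
Qed.

End Charts.

(** * Differentials of functions and smooth fields *)

Section SmoothTensors.
Context {R : realType} {n : nat} {M : manifold R n}.
Implicit Types (c : chart R n M) (x : M) (U V : set M) (f g : M -> R).
Implicit Types (X Y : vector_field M) (a b : one_form M).

Lemma smooth_fun_mono U V f : V `<=` U -> smooth_fun U f -> smooth_fun V f.
Proof.
move=> VU sf c ac; apply: smooth_on_mono (sf c ac).
by move=> _ [x [/VU Ux cx] <-]; exists x.
Qed.

Lemma smooth_vector_field_mono U V X : V `<=` U -> smooth_vector_field U X ->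
  smooth_vector_field V X.
Proof.
move=> VU sf c ac j; apply: smooth_on_mono (sf c ac j).
by move=> _ [x [/VU Ux cx] <-]; exists x.
Qed.

Lemma smooth_one_form_mono U V a : V `<=` U -> smooth_one_form U a ->
  smooth_one_form V a.
Proof.
move=> VU sf c ac j; apply: smooth_on_mono (sf c ac j).
by move=> _ [x [/VU Ux cx] <-]; exists x.
Qed.

Lemma smooth_fun_eq U f g : open U -> (forall x, U x -> f x = g x) ->
  smooth_fun U f -> smooth_fun U g.
Proof.
move=> oU fg sf c ac; apply: smooth_on_eq (sf c ac); first exact: open_coord.
by move=> z /coord_image[Uz _ _] /=; exact: fg.
Qed.

Lemma smooth_funD U f g : open U -> smooth_fun U f -> smooth_fun U g ->
  smooth_fun U (fun x => f x + g x).
Proof.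
by move=> oU sf sg c ac; apply: smooth_onD (sf c ac) (sg c ac);
  exact: open_coord.
Qed.

Lemma smooth_funM U f g : open U -> smooth_fun U f -> smooth_fun U g ->
  smooth_fun U (fun x => f x * g x).
Proof.
by move=> oU sf sg c ac; apply: smooth_onM (sf c ac) (sg c ac);
  exact: open_coord.
Qed.

Lemma smooth_fun_cst U (r : R) : smooth_fun U (fun=> r).
Proof. by move=> c ac; exact: smooth_on_cst. Qed.

(** A single chart is enough to test smoothness: in another one, [f] is composed with a smooth
    transition map. *)
Lemma smooth_fun_chart c U f : atlas c -> open U -> U `<=` dom c ->
  smooth_on (coord c @` U) (f \o param c) -> smooth_fun U f.
Proof.
move=> ac oU Uc sf c' ac'.
apply: (@smooth_on_eq _ _ _ ((f \o param c) \o (coord c \o param c'))).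
- exact: open_coord.
- by move=> z /coord_image[/Uc cz _ _] /=; rewrite coordK.
apply: smooth_on_comp sf _ => [|z /coord_image[Uz _ _]|j].
- exact: open_coord.
- exact: imageP.
- exact: transition_smooth.
Qed.

Lemma smooth_coord c j : atlas c -> smooth_fun (dom c) (fun y => coord c y 0 j).
Proof. by move=> ac c' ac'; exact: transition_smooth. Qed.

(** The preferred chart matches the definition of [dfun]; [diff_at_chart] transfers the condition to
    any other chart. *)
Definition diff_at f x : Prop :=
  differentiable (f \o param (chart_at x)) (coord (chart_at x) x).

Lemma smooth_fun_differentiable c U f x : atlas c -> smooth_fun U f -> U x ->
  dom c x -> differentiable (f \o param c) (coord c x).
Proof.
by move=> ac sf Ux cx; apply: (smooth_on_differentiable (sf c ac)); exists x.
Qed.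

Lemma smooth_diff_at U f x : smooth_fun U f -> U x -> diff_at f x.
Proof.
move=> sf Ux; apply: smooth_fun_differentiable sf Ux _;
  first exact: chart_at_atlas.
exact: chart_at_dom.
Qed.

Lemma diff_at_chart c f x : atlas c -> dom c x -> diff_at f x ->
  differentiable (f \o param c) (coord c x).
Proof.
move=> ac cx df.
have dt := transition_differentiable ac (chart_at_atlas x) cx (chart_at_dom x).
have E := near_transition f cx (chart_at_dom x).
apply: (near_eq_differentiable (f := (f \o param (chart_at x)) \o
  (coord (chart_at x) \o param c))); first by apply: filterS E => z ->.
by apply: differentiable_comp dt _; rewrite /= coordK.
Qed.

(** The chain rule moves the derivative from the preferred chart, where [dfun] is defined, to any
    chart around [x]. *)
Lemma pair_dfun c x f (v : tangent x) : atlas c -> dom c x -> diff_at f x ->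
  pair (dfun f x) v = 'D_(vec_comp c v) (f \o param c) (coord c x).
Proof.
move=> ac cx df.
have a0 := chart_at_atlas x; have x0 := chart_at_dom x.
rewrite /vec_comp -(derive_chart _ a0 ac x0 cx); last exact: diff_at_chart.
rewrite derive_deltaE // /pair mxE.
by apply: eq_bigr => i _; rewrite mxE.
Qed.

(** Multiplying [v] by the Jacobian matrix differentiates the transition map along [v]. Vector
    components thus become values of differentials of functions. *)
Lemma vec_comp_pair c x (v : tangent x) j : atlas c -> dom c x ->
  vec_comp c v 0 j = pair (coord_covec c j x) v.
Proof.
move=> ac cx; have a0 := chart_at_atlas x; have x0 := chart_at_dom x.
have dt := transition_differentiable a0 ac x0 cx.
rewrite (@pair_dfun (chart_at x)) //;
  last exact: smooth_diff_at (smooth_coord j ac) cx.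
rewrite vec_comp_chart_at /vec_comp -[in LHS](deriveEjacobian _ dt).
exact: derive_rVE.
Qed.

Lemma covec_expand c x (b : cotangent x) : atlas c -> dom c x ->
  b = \sum_(i < n) covec_comp c b i 0 *: coord_covec c i x :> cotangent x.
Proof.
move=> ac cx; apply: pair_ext => v; rewrite (pair_comp _ _ ac cx) pair_suml.
by apply: eq_bigr => i _; rewrite pairZl vec_comp_pair // mulrC.
Qed.

Lemma pair_dfun_coord_vec c x f i : atlas c -> dom c x -> diff_at f x ->
  pair (dfun f x) (coord_vec c i x) = 'D_(delta_mx 0 i) (f \o param c) (coord c
    x).
Proof.
move=> ac cx df; rewrite (pair_dfun _ ac cx df) vec_comp_coord_vec //.
by rewrite transition_jac_id // row1.
Qed.

Lemma pair_coord c x i j : atlas c -> dom c x ->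
  pair (coord_covec c j x) (coord_vec c i x) = (i == j)%:R.
Proof.
move=> ac cx; rewrite -vec_comp_pair // vec_comp_coord_vec // transition_jac_id
  //.
by rewrite !mxE.
Qed.

Lemma smooth_dfun U f : open U -> smooth_fun U f -> smooth_one_form U (dfun f).
Proof.
move=> oU sf c ac i.
apply: smooth_on_eq (smooth_on_derive (delta_mx 0 i) (sf c ac)).
  exact: open_coord.
move=> z /coord_image[Uz cz zE]; rewrite covec_comp_pair pair_dfun_coord_vec
  ?zE //.
exact: smooth_diff_at sf Uz.
Qed.

Lemma smooth_pair U a X : open U -> smooth_one_form U a ->
  smooth_vector_field U X -> smooth_fun U (fun x => pair (a x) (X x)).
Proof.
move=> oU sa sX c ac; have oc := open_coord (c := c) oU.
apply: (smooth_on_eq oc _ (smooth_on_sum oc (fun i =>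
  smooth_onM oc (sX c ac i) (sa c ac i)))).
by move=> z /coord_image[_ cz _] /=; rewrite (pair_comp _ _ ac cz).
Qed.

(** Reduces smoothness of a field to that of scalar functions, the form in which brackets are
    accessible. *)
Lemma smooth_vector_fieldP U X : open U -> smooth_vector_field U X <->
  forall c j, atlas c ->
    smooth_fun (U `&` dom c) (fun x => pair (coord_covec c j x) (X x)).
Proof.
move=> oU; split=> [sX c j ac|sX c ac j].
  have oUc : open (U `&` dom c) by apply: openI => //; exact: dom_open.
  apply: smooth_pair => //; last exact: smooth_vector_field_mono sX.
  apply: smooth_dfun => //; apply: smooth_fun_mono (smooth_coord j ac).
  exact: subIsetr.
have := sX c j ac c ac; rewrite -setIA setIid => sXc.
apply: smooth_on_eq sXc; first exact: open_coord.
by move=> z /coord_image[_ cz _] /=; rewrite vec_comp_pair.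
Qed.

Lemma smooth_fun_derive c U f i : atlas c -> open U -> U `<=` dom c ->
  smooth_fun U f ->
  smooth_fun U (fun x => pair (dfun f x) (coord_vec c i x)).
Proof.
move=> ac oU Uc sf; apply: (smooth_fun_chart ac oU Uc).
have UE : U = U `&` dom c by rewrite setIidl.
have oc : open (coord c @` U) by rewrite UE; exact: open_coord.
have sfc : smooth_on (coord c @` U) (f \o param c) by rewrite UE; exact: sf.
apply: smooth_on_eq (smooth_on_derive (delta_mx 0 i) sfc) => //.
move=> z; rewrite {1}UE => /coord_image[Uz cz zE] /=.
by rewrite pair_dfun_coord_vec ?zE //; exact: smooth_diff_at sf Uz.
Qed.

Lemma smooth_coord_vec c i : atlas c -> smooth_vector_field (dom c) (coord_vec
  c i).
Proof.
move=> ac; apply/smooth_vector_fieldP; first exact: dom_open.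
move=> c' j ac'; apply: smooth_fun_derive => //.
  by apply: openI; exact: dom_open.
exact: smooth_fun_mono (smooth_coord j ac').
Qed.

Lemma dfun_eq U f g x : open U -> U x -> (forall y, U y -> f y = g y) ->
  dfun f x = dfun g x.
Proof.
move=> oU Ux fg; apply/colP => i; rewrite !mxE.
apply: near_eq_derive; have := near_param (chart_at_dom x) (open_nbhs_nbhs
  (conj oU Ux)).
by apply: filterS => z; exact: fg.
Qed.

Lemma dfunD f g x : diff_at f x -> diff_at g x ->
  dfun (fun y => f y + g y) x = dfun f x + dfun g x.
Proof.
move=> df dg; apply/colP => i; rewrite !mxE.
exact: (@derive_add _ _ (f \o param _) (g \o param _)).
Qed.

Lemma dfunM f g x : diff_at f x -> diff_at g x ->
  dfun (fun y => f y * g y) x = g x *: dfun f x + f x *: dfun g x.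
Proof.
move=> df dg; apply/colP => i; rewrite !mxE.
rewrite (@derive_mul _ _ (f \o param _) (g \o param _)) //=.
by rewrite coordK ?(mulrC (g x)) //; exact: chart_at_dom.
Qed.

Lemma dfun_cst (r : R) x : dfun (fun=> r) x = 0 :> cotangent x.
Proof. by apply/colP => i; rewrite !mxE; exact: derive_cst. Qed.

Lemma dfun_sum m (f : 'I_m -> M -> R) x : (forall i, diff_at (f i) x) ->
  dfun (fun y => \sum_(i < m) f i y) x = \sum_(i < m) dfun (f i) x.
Proof.
move=> df; apply/colP => i; rewrite summxE mxE.
rewrite (@derive_bigsum _ _ _ (fun j => f j \o param _)) //.
by apply: eq_bigr => j _; rewrite mxE.
Qed.

End SmoothTensors.

(** * Lie brackets and Lie derivatives *)

Section LieBracket.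
Context {R : realType} {n : nat} {M : manifold R n}.
Implicit Types (c : chart R n M) (x : M) (U V : set M) (f g : M -> R).
Implicit Types (X Y : vector_field M) (a b : one_form M).

(* Schwarz: the second derivatives D_(X x) D_(Y x) f are symmetric in X, Y. *)
Lemma lie_bracketE U f X Y x : open U -> U x -> smooth_fun U f ->
  smooth_vector_field U X -> smooth_vector_field U Y ->
  pair (dfun f x) (lie_bracket X Y x) =
  pair (dfun (fun y => pair (dfun f y) (Y y)) x) (X x)
  - pair (dfun (fun y => pair (dfun f y) (X y)) x) (Y x).
Proof.
move=> oU Ux sf sX sY.
have ac := chart_at_atlas x; have cx := chart_at_dom x.
set c := chart_at x in ac cx *.
pose O := coord c @` (U `&` dom c); have oO : open O by exact: open_coord.
have Oz : O (coord c x) by exists x.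
pose F := f \o param c; have sF : smooth_on O F by exact: sf.
have dF z : O z -> differentiable F z by exact: smooth_on_differentiable.
have dDF v z : O z -> differentiable ('D_v F) z.
  by apply: smooth_on_differentiable; exact: smooth_on_derive.
have second (Z T : vector_field M) : smooth_vector_field U Z ->
    pair (dfun (fun y => pair (dfun f y) (Z y)) x) (T x) =
    \sum_(j < n) 'D_(T x) (fun z => vec_comp c (Z (param c z)) 0 j) (coord c x)
      * 'D_(delta_mx 0 j) F (coord c x) + 'D_(Z x) ('D_(T x) F) (coord c x).
  move=> sZ.
  have sZc j : smooth_on O (fun z => vec_comp c (Z (param c z)) 0 j).
    exact: sZ.
  have sp : smooth_fun U (fun y => pair (dfun f y) (Z y)).
    by apply: smooth_pair => //; exact: smooth_dfun.
  rewrite (pair_dfun _ ac cx (smooth_diff_at sp Ux)) vec_comp_chart_at.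
  have E : \forall z \near coord c x,
      ((fun y => pair (dfun f y) (Z y)) \o param c) z =
      \sum_(j < n) vec_comp c (Z (param c z)) 0 j * 'D_(delta_mx 0 j) F z.
    apply: filterS (nbhs_coord oU Ux cx) => z /coord_image[Uz cz zE] /=.
    rewrite (pair_dfun _ ac cz (smooth_diff_at sf Uz)) zE derive_deltaE //.
    by apply: dF; exists (param c z).
  rewrite (near_eq_derive _ E) derive_bigsum; last first.
    move=> j; apply: differentiableM; last exact: dDF.
    exact: smooth_on_differentiable (sZc j) Oz.
  rewrite (derive_deltaE (Z x) (dDF _ _ Oz)) -big_split /=;
    apply: eq_bigr => j _.
  rewrite derive_mul; last exact: dDF;
    last exact: smooth_on_differentiable (sZc j) Oz.
  rewrite (coordK cx) (vec_comp_chart_at (Z x)).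
  by rewrite (smooth_on_deriveC (T x) (delta_mx 0 j) oO Oz sF).
rewrite (second _ _ sX) (second _ _ sY) (smooth_on_deriveC (Y x) (X x) oO Oz
  sF).
rewrite opprD addrACA subrr addr0 -sumrB.
rewrite (pair_dfun _ ac cx (smooth_diff_at sf Ux)) vec_comp_chart_at.
rewrite (derive_deltaE _ (dF _ Oz)); apply: eq_bigr => j _.
rewrite /lie_bracket mxE -/c coordK // !vec_comp_chart_at.
by rewrite mulrBl.
Qed.

Lemma smooth_lie_bracket U X Y : open U -> smooth_vector_field U X ->
  smooth_vector_field U Y -> smooth_vector_field U (lie_bracket X Y).
Proof.
move=> oU sX sY; apply/smooth_vector_fieldP => // c j ac.
have oUc : open (U `&` dom c) by apply: openI => //; exact: dom_open.
have sc : smooth_fun (U `&` dom c) (fun y => coord c y 0 j).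
  by apply: smooth_fun_mono (smooth_coord j ac); exact: subIsetr.
have sX' := smooth_vector_field_mono (@subIsetl _ U (dom c)) sX.
have sY' := smooth_vector_field_mono (@subIsetl _ U (dom c)) sY.
have second Z T : smooth_vector_field (U `&` dom c) Z ->
    smooth_vector_field (U `&` dom c) T -> smooth_fun (U `&` dom c)
    (fun x => pair (dfun (fun y => pair (coord_covec c j y) (Z y)) x) (T x)).
  move=> sZ sT; apply: smooth_pair => //; apply: smooth_dfun => //.
  by apply: smooth_pair => //; exact: smooth_dfun.
apply: (smooth_fun_eq oUc _ (smooth_funD oUc (second _ _ sY' sX')
  (smooth_funM oUc (smooth_fun_cst _ (-1)) (second _ _ sX' sY')))).
by move=> x Ux; rewrite (lie_bracketE oUc Ux sc sX' sY') mulN1r.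
Qed.

(** This is L_X(f dg) = (Xf) dg + f d(Xg): the terms (Xg) df of d i(X) and of i(X) d cancel. The
    functions g will be adapted coordinates, or a single function for an exact form. *)
Lemma lie_derivativeE U m (f g : 'I_m -> M -> R) X b x : open U -> U x ->
  (forall j, smooth_fun U (f j)) -> (forall j, smooth_fun U (g j)) ->
  smooth_vector_field U X ->
  (forall y, U y -> b y = \sum_(j < m) f j y *: dfun (g j) y) ->
  lie_derivative X b x =
  \sum_(j < m) (pair (dfun (f j) x) (X x) *: dfun (g j) x
    + f j x *: dfun (fun y => pair (dfun (g j) y) (X y)) x).
Proof.
move=> oU Ux sf sg sX bE.
have ac := chart_at_atlas x; have cx := chart_at_dom x.
set c := chart_at x in ac cx *.
pose O := coord c @` (U `&` dom c); have oO : open O by exact: open_coord.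
have Oz : O (coord c x) by exists x.
have dX j : smooth_fun U (fun y => pair (dfun (g j) y) (X y)).
  by apply: smooth_pair => //; exact: smooth_dfun.
have E1 : dfun (fun y => pair (b y) (X y)) x = \sum_(j < m)
    (pair (dfun (g j) x) (X x) *: dfun (f j) x
    + f j x *: dfun (fun y => pair (dfun (g j) y) (X y)) x) :> cotangent x.
  rewrite (@dfun_eq _ _ _ U _
    (fun y => \sum_(j < m) f j y * pair (dfun (g j) y) (X y))) //; last first.
    by move=> y Uy; rewrite bE // pair_suml; apply: eq_bigr => j _;
      rewrite pairZl.
  rewrite (@dfun_sum _ _ _ _ (fun j y => f j y * pair (dfun (g j) y) (X y))).
    by apply: eq_bigr => j _; rewrite dfunM //; apply: smooth_diff_at Ux.
  move=> j; apply: (@smooth_diff_at _ _ _ U) => //.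
  by apply: smooth_funM.
(* Besides products of first derivatives, a second derivative of g appears; being symmetric in l and
   k, it drops out of [dform b]. *)
have E2 l k : 'D_(delta_mx 0 l) (fun z => covec_comp c (b (param c z)) k 0)
    (coord c x) = \sum_(j < m) (dfun (f j) x l 0 * dfun (g j) x k 0
    + f j x * 'D_(delta_mx 0 l) ('D_(delta_mx 0 k) (g j \o param c)) (coord c
      x)).
  have E : \forall z \near coord c x, covec_comp c (b (param c z)) k 0 =
      \sum_(j < m) (f j \o param c) z * 'D_(delta_mx 0 k) (g j \o param c) z.
    apply: filterS (nbhs_coord oU Ux cx) => z /coord_image[Uz cz zE].
    rewrite covec_comp_pair bE // pair_suml; apply: eq_bigr => j _.
    by rewrite pairZl pair_dfun_coord_vec // ?zE //;
      exact: smooth_diff_at (sg j) Uz.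
  have dG j : differentiable ('D_(delta_mx 0 k) (g j \o param c)) (coord c x).
    exact: smooth_on_differentiable (smooth_on_derive _ (sg j c ac)) Oz.
  have dFj j : differentiable (f j \o param c) (coord c x).
    exact: smooth_on_differentiable (sf j c ac) Oz.
  rewrite (near_eq_derive _ E) derive_bigsum; last first.
    by move=> j; apply: differentiableM.
  apply: eq_bigr => j _.
  rewrite (@derive_mul _ _ (f j \o param c)) //=.
  by rewrite !mxE -/c coordK.
have E3 k : (X x *m dform b x) 0 k = \sum_(j < m)
    (pair (dfun (f j) x) (X x) * dfun (g j) x k 0
     - pair (dfun (g j) x) (X x) * dfun (f j) x k 0).
  rewrite mxE.
  transitivity (\sum_(l < n) \sum_(j < m) X x 0 l *
      (dfun (f j) x l 0 * dfun (g j) x k 0 - dfun (g j) x l 0 * dfun (f j) x k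
        0)).
    apply: eq_bigr => l _; rewrite /dform mxE -/c !E2 -sumrB mulr_sumr.
    apply: eq_bigr => j _; congr (_ * _).
    rewrite (smooth_on_deriveC (delta_mx 0 k) (delta_mx 0 l) oO Oz (sg j c ac)).
    by rewrite opprD addrACA subrr addr0 [dfun (f j) x k 0 * _]mulrC.
  rewrite exchange_big /=; apply: eq_bigr => j _.
  rewrite /pair [in RHS]mxE [X in _ = _ - X * _]mxE !mulr_suml -sumrB.
  by apply: eq_bigr => l _; rewrite mulrBr !mulrA.
apply/colP => k; rewrite /lie_derivative mxE [X in _ + X]mxE E3 E1 !summxE.
rewrite -big_split /=; apply: eq_bigr => j _; rewrite !mxE.
by ring.
Qed.

End LieBracket.

(** * Foliations *)

Section Restriction.
Context {R : realType} {n : nat} {M : manifold R n}.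
Variables (c : chart R n M) (B : set 'rV[R]_n).
Hypotheses (oB : open B) (Bc : B `<=` coord c @` dom c).

Lemma restrict_dom_open : open (dom c `&` coord c @^-1` B).
Proof.
rewrite openE => x [cx Bx]; rewrite /interior.
apply: filterI; first by apply: open_nbhs_nbhs; split=> //; exact: dom_open.
by apply: (coord_continuous cx); exact: open_nbhs_nbhs.
Qed.

Lemma restrict_img : coord c @` (dom c `&` coord c @^-1` B) = B.
Proof.
apply/seteqP; split=> [_ [x [_ Bx] <-] //|z Bz].
by have [x cx xz] := Bc Bz; exists x => //; split=> //=; rewrite xz.
Qed.

Lemma restrict_img_open : open (coord c @` (dom c `&` coord c @^-1` B)).
Proof. by rewrite restrict_img. Qed.

(** The new domain is prescribed by its image [B], since being adapted involves the shape of the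
    image. *)
Definition restrict_chart : chart R n M := {|
  dom := dom c `&` coord c @^-1` B;
  coord := coord c;
  param := param c;
  dom_open := restrict_dom_open;
  img_open := restrict_img_open;
  coordK := fun x cx => coordK (proj1 cx);
  coord_continuous := fun x cx => coord_continuous (proj1 cx);
  param_continuous := fun z cz => param_continuous
    (@image_subset _ _ (coord c) _ _ (@subIsetl _ _ _) z cz) |}.

Lemma restrict_atlas : atlas c -> atlas restrict_chart.
Proof.
move=> ac; apply: atlas_maximal => c' ac'.
have [s1 s2] := atlas_compatible ac ac'; split=> j.
  by apply: smooth_on_mono (s1 j) => _ [x [[cx _] c'x] <-]; exists x.
by apply: smooth_on_mono (s2 j) => _ [x [c'x [cx _]] <-]; exists x.
Qed.

End Restriction.

Lemma derive_line_cst {R : realType} {V : normedModType R} (f : V -> R) z w :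
  differentiable f z -> (\forall s \near (0 : R), f (z + s *: w) = f z) ->
  'D_w f z = 0.
Proof.
move=> df fz; have zE : z + (0 : R) *: w = z by rewrite scale0r addr0.
have dfw : derivable f (z + (0 : R) *: w) w by rewrite zE;
  exact: diff_derivable.
have [_] := is_derive_line dfw; rewrite zE => <-.
rewrite (@near_eq_derive _ _ _ _ (fun=> f z)) //.
exact: derive_cst.
Qed.

(** * Tangent and conormal vectors, leaves, projectable functions and forms *)

Section Leaves.
Context {R : realType} {q p : nat} {M : manifold R (q + p)}.
Variable F : foliation M.
Implicit Types (c : chart R (q + p) M) (x : M) (U : set M) (f : M -> R).

(** A ball of the coordinate space is, for the sup norm, a product of intervals, so an adapted chart
    restricted to it keeps a box image; maximality of the adapted atlas admits the restriction. *)
Lemma adapted_restrict U x : open U -> U x ->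
  exists c, [/\ adapted F c, dom c `<=` U & dom c x].
Proof.
move=> oU Ux; have [c0 ac0 cx] := adapted_cover F x.
have [e /= e0 eU] := (nbhs_ballP _ _).1 (nbhs_coord oU Ux cx).
have Bc : ball (coord c0 x) e `<=` coord c0 @` dom c0.
  by move=> z /eU[y [_ cy] <-]; exists y.
pose c := restrict_chart (ball_open (coord c0 x) e) Bc.
have cU : dom c `<=` U.
  move=> y [cy /eU[y' [Uy' cy'] yE]].
  by rewrite -(coordK cy) -yE coordK.
exists c; split=> //; last by split=> //=; exact: ballxx.
apply: adapted_maximal.
- exact: restrict_atlas (adapted_atlas ac0).
- exists (fun i => ball (coord c0 x 0 i) e).
    move=> i r s; rewrite -ball_normE /ball_ /= => re se t /andP[rt ts].
    move: re se; rewrite !ltr_distl => /andP[r1 r2] /andP[s1 s2].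
    by apply/andP; split; lra.
  rewrite /= restrict_img //; apply/seteqP; split=> z /= Bz.
    by move=> i; exact: Bz.2.
  by split=> // i j; rewrite ord1; exact: Bz.
- move=> c' ac'; split.
    by move=> y [cy _] c'y; exact: (adapted_compatible ac0 ac' cy c'y).
  by move=> y c'y [cy _]; exact: (adapted_compatible ac' ac0 c'y cy).
Qed.

Lemma vec_comp_surj c x (w : 'rV[R]_(q + p)) : atlas c -> dom c x ->
  exists v : tangent x, vec_comp c v = w.
Proof.
move=> ac cx; have a0 := chart_at_atlas x; have x0 := chart_at_dom x.
exists (w *m transition_jac c (chart_at x) x).
by rewrite /vec_comp -mulmxA transition_jac_comp // transition_jac_id // mulmx1.
Qed.

Lemma near_line c x (w : 'rV[R]_(q + p)) (P : set M) : dom c x -> nbhs x P ->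
  \forall s \near (0 : R), [/\ dom c (param c (coord c x + s *: w)),
    coord c (param c (coord c x + s *: w)) = coord c x + s *: w &
    P (param c (coord c x + s *: w))].
Proof.
move=> cx Px.
have cvl : (fun s : R => coord c x + s *: w) s @[s --> (0 : R)] --> coord c x.
  rewrite -[X in _ --> X]addr0 -(scale0r w).
  by apply: cvgD; [exact: cvg_cst|exact: scalel_continuous].
have : nbhs (coord c x) [set z | (coord c @` dom c) z /\ P (param c z)].
  apply: filterI; last exact: near_param.
  by apply: open_nbhs_nbhs; split; [exact: img_open|exact: imageP].
move=> /cvl; apply: (@filterS _ _ (nbhs_filter (0 : R))) => s [[y cy yE] Ps].
by split; rewrite // -yE coordK.
Qed.

(** One adapted chart suffices: on a short segment in direction [v] the x^a of [c] do not vary,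
    hence neither do those of [c'], and their derivatives along [v] vanish. *)
Lemma in_TF_chart c x (v : tangent x) : adapted F c -> dom c x ->
  lsubmx (vec_comp c v) = 0 -> in_TF F v.
Proof.
move=> Fc cx v0 c' Fc' c'x; have ac := adapted_atlas Fc.
have ac' := adapted_atlas Fc'; apply/rowP => i; rewrite mxE [RHS]mxE.
have df : diff_at (fun y => coord c' y 0 (lshift p i)) x.
  exact: smooth_diff_at (smooth_coord _ ac') c'x.
rewrite vec_comp_pair // (pair_dfun _ ac cx df).
apply: derive_line_cst; first exact: diff_at_chart.
have [N Nx tN] := adapted_compatible Fc Fc' cx c'x.
apply: filterS (near_line (vec_comp c v) cx Nx) => s [cs sE Ns].
have : tcoord c (param c (coord c x + s *: vec_comp c v)) = tcoord c x.
  by rewrite /tcoord sE linearD linearZ /= v0 scaler0 addr0.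
move=> /(tN _ _ Ns (nbhs_singleton Nx)) /rowP/(_ i).
by rewrite /tcoord !mxE /= coordK.
Qed.

Lemma coord_vec_TF c x (u : 'I_p) : adapted F c -> dom c x ->
  in_TF F (coord_vec c (rshift q u) x).
Proof.
move=> Fc cx; have ac := adapted_atlas Fc; apply: (in_TF_chart Fc cx).
apply/rowP => i; rewrite mxE [RHS]mxE vec_comp_pair // pair_coord //.
by rewrite eq_rlshift.
Qed.

Lemma conormal_chart c x (b : cotangent x) : adapted F c -> dom c x ->
  (forall u, pair b (coord_vec c (rshift q u) x) = 0) -> conormal F b.
Proof.
move=> Fc cx b0 v vT; rewrite (pair_comp _ _ (adapted_atlas Fc) cx)
  big_split_ord /=.
rewrite !big1 ?addr0 // => i _; first by rewrite covec_comp_pair b0 mulr0.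
have := vT c Fc cx => /rowP/(_ i); rewrite mxE [RHS]mxE => ->.
by rewrite mul0r.
Qed.

Lemma conormalD x (a b : cotangent x) : conormal F a -> conormal F b ->
  conormal F (a + b : cotangent x).
Proof. by move=> a0 b0 v vT; rewrite pairDl a0 // b0 // addr0. Qed.

Lemma conormalZ x (r : R) (a : cotangent x) : conormal F a ->
  conormal F (r *: a : cotangent x).
Proof. by move=> a0 v vT; rewrite pairZl a0 // mulr0. Qed.

Lemma conormal_sum x m (a : 'I_m -> cotangent x) :
  (forall i, conormal F (a i)) -> conormal F (\sum_(i < m) a i : cotangent x).
Proof. by move=> a0 v vT; rewrite pair_suml big1 // => i _; rewrite a0. Qed.

Lemma conormal_coord c x (i : 'I_q) : adapted F c -> dom c x ->
  conormal F (coord_covec c (lshift p i) x).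
Proof.
move=> Fc cx v vT; rewrite -(vec_comp_pair _ _ (adapted_atlas Fc) cx).
by have := vT c Fc cx => /rowP/(_ i); rewrite mxE [RHS]mxE.
Qed.

Lemma conormal_expand c x (b : cotangent x) : adapted F c -> dom c x ->
  conormal F b ->
  b = \sum_(i < q) covec_comp c b (lshift p i) 0 *: coord_covec c (lshift p i)
    x.
Proof.
move=> Fc cx b0; rewrite [LHS](covec_expand b (adapted_atlas Fc) cx).
rewrite big_split_ord /= [X in _ + X]big1 ?addr0 // => u _.
by rewrite covec_comp_pair b0 ?scale0r //; exact: coord_vec_TF.
Qed.

(** A vertical derivative is taken along a segment of a plaque. Conversely, two points of a plaque
    are joined by a segment inside the box, to which the mean value theorem applies. *)
Lemma plaque_constP c f : adapted F c -> smooth_fun (dom c) f ->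
  (forall x y, dom c x -> dom c y -> tcoord c x = tcoord c y -> f x = f y) <->
  (forall x, dom c x -> conormal F (dfun f x)).
Proof.
move=> Fc sf; have ac := adapted_atlas Fc;
  split=> [fc x cx v vT|f0 x y cx cy xy].
  have df := smooth_diff_at sf cx.
  rewrite (pair_dfun _ ac cx df); apply: derive_line_cst;
    first exact: diff_at_chart.
  apply: filterS (near_line (vec_comp c v) cx filterT) => s [cs sE _] /=.
  apply: fc; rewrite ?coordK // /tcoord sE linearD linearZ /= (vT c Fc cx).
  by rewrite scaler0 addr0.
pose w := coord c y - coord c x.
have [I Iint IE] := adapted_box Fc.
(* Each coordinate lies between those of the two ends, hence in the interval [I i]. *)
have seg (s : R) : 0 <= s <= 1 -> (coord c @` dom c) (coord c x + s *: w).
  move=> /andP[s0 s1]; rewrite IE => i /=; rewrite !mxE.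
  have Ix : I i (coord c x 0 i).
    by have : (coord c @` dom c) (coord c x) by []; rewrite IE; exact.
  have Iy : I i (coord c y 0 i).
    by have : (coord c @` dom c) (coord c y) by []; rewrite IE; exact.
  have [le|/ltW le] := leP (coord c x 0 i) (coord c y 0 i).
    apply: (Iint i _ _ Ix Iy); apply/andP; split; nra.
  apply: (Iint i _ _ Iy Ix); apply/andP; split; nra.
have Dw (s : R) : 0 <= s <= 1 ->
    differentiable (f \o param c) (coord c x + s *: w) /\
    'D_w (f \o param c) (coord c x + s *: w) = 0.
  move=> /seg[z cz zE]; rewrite -zE.
  have df := smooth_diff_at sf cz.
  split; first exact: diff_at_chart.
  have [v vE] := vec_comp_surj w ac cz; rewrite -vE -(pair_dfun _ ac cz df).
  apply: f0 => //; apply: (in_TF_chart Fc cz); rewrite vE linearB /=.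
  by move: xy; rewrite /tcoord => ->; rewrite subrr.
have [|s s01] := @MVT_line R _ (f \o param c) (coord c x) w 1 ler01.
  by move=> s /Dw[? _]; exact: diff_derivable.
have [_ ->] := Dw _ s01; rewrite scale1r mulr0 /w subrKC /= !coordK //.
by move=> /subr0_eq.
Qed.

(** Leaves of U are chains of plaques of adapted charts contained in U, and every point of U lies in
    such a chart: constancy can be tested plaque by plaque, hence by the differential. *)
Lemma foliated_funP U f : open U ->
  foliated_fun F U f <->
  smooth_fun U f /\ (forall x, U x -> conormal F (dfun f x)).
Proof.
move=> oU; split=> [[sf fl]|[sf f0]]; split=> //.
  move=> x Ux; have [c [Fc cU cx]] := adapted_restrict oU Ux.
  apply: (plaque_constP Fc (smooth_fun_mono cU sf)).1 cx => y z cy cz yz.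
  by apply: fl; [exact: cU|exact: cU|apply: Relation_Operators.rst_step;
    exists c].
move=> x y _ _; elim=> // {x y} [x y [c [Fc cU cx cy xy]]|x y z _ -> _ -> //].
by apply: (plaque_constP Fc (smooth_fun_mono cU sf)).2 cx cy xy => z /cU;
  exact: f0.
Qed.

Lemma foliated_coord c (i : 'I_q) : adapted F c ->
  foliated_fun F (dom c) (fun y => coord c y 0 (lshift p i)).
Proof.
move=> Fc; apply/foliated_funP; first exact: dom_open.
split; first exact: smooth_coord (adapted_atlas Fc).
by move=> x cx; exact: conormal_coord.
Qed.

(** The value at a point of R^q is that of [f] anywhere on the plaque above it; [t0] fills in where
    there is no plaque. *)
Lemma factor_tcoord (T : choiceType) (t0 : T) c (f : M -> T) :
  (forall x y, dom c x -> dom c y -> tcoord c x = tcoord c y -> f x = f y) ->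
  exists g : 'rV[R]_q -> T, forall x, dom c x -> f x = g (tcoord c x).
Proof.
move=> fc; exists (fun t => xget t0 [set r | exists2 y, dom c y /\ tcoord c y =
  t & r = f y]).
move=> x cx; case: xgetP => [r _ [y [cy yx] ->]|/(_ (f x)) []];
  last by exists x.
exact/esym/fc.
Qed.

Lemma foliated_one_form_conormal U (a : one_form M) x : open U ->
  foliated_one_form F U a -> U x -> conormal F (a x).
Proof.
move=> oU [_ fa] Ux; have [c [Fc cU cx]] := adapted_restrict oU Ux.
have [g gE] := fa c Fc cU; rewrite gE //; apply: conormal_sum => i.
by apply: conormalZ; exact: conormal_coord.
Qed.

Lemma foliated_one_form_mono U V (a : one_form M) : V `<=` U ->
  foliated_one_form F U a -> foliated_one_form F V a.
Proof.
move=> VU [sa fa]; split; first exact: smooth_one_form_mono sa.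
by move=> c Fc cV; apply: fa => // x /cV/VU.
Qed.

(** The coefficients of df are the derivatives of [f] along the x^i. They are constant on plaques
    because vertical derivatives commute with these and kill [f]. *)
Lemma foliated_dfun U f : open U -> foliated_fun F U f ->
  foliated_one_form F U (dfun f).
Proof.
move=> oU /(foliated_funP _ oU)[sf f0]; split; first exact: smooth_dfun.
move=> c Fc cU; have ac := adapted_atlas Fc; have oc := @dom_open _ _ _ c.
have sfc := smooth_fun_mono cU sf.
pose g (i : 'I_q) x := pair (dfun f x) (coord_vec c (lshift p i) x).
have sg i : smooth_fun (dom c) (g i) by exact: smooth_fun_derive.
have g0 i x : dom c x -> conormal F (dfun (g i) x).
  move=> cx v vT.
  rewrite (pair_dfun _ ac cx (smooth_diff_at (sg i) cx)).
  set w := vec_comp c v; pose e : 'rV[R]_(q + p) := delta_mx 0 (lshift p i).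
  pose O := coord c @` dom c; have oO : open O by exact: img_open.
  have Oz : O (coord c x) by exact: imageP.
  have sF : smooth_on O (f \o param c).
    by rewrite /O -[dom c]setIid; exact: sfc.
  have E : \forall z \near coord c x, (g i \o param c) z = 'D_e (f \o param c)
    z.
    apply: filterS (open_nbhs_nbhs (conj oO Oz)) => _ [y cy <-] /=.
    by rewrite coordK // /g pair_dfun_coord_vec //;
      exact: smooth_diff_at sfc cy.
  rewrite (near_eq_derive _ E) (smooth_on_deriveC e w oO Oz sF).
  (* The vector of components [w] is vertical at every point of the domain, not only at [x]; so
     ['D_w] of [f] vanishes near [x] and can be differentiated. *)
  have E0 : \forall z \near coord c x, 'D_w (f \o param c) z = cst 0 z.
    apply: filterS (open_nbhs_nbhs (conj oO Oz)) => _ [y cy <-] /=.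
    have [u uE] := vec_comp_surj w ac cy.
    have uT : in_TF F u by apply: (in_TF_chart Fc cy); rewrite uE; exact: vT.
    have := f0 y (cU y cy) u uT.
    by rewrite (pair_dfun u ac cy (smooth_diff_at sfc cy)) uE.
  by rewrite (near_eq_derive _ E0); exact: derive_cst.
have fac i := factor_tcoord 0 ((plaque_constP Fc (sg i)).2 (g0 i)).
exists (fun i => sval (cid (fac i))) => x cx.
rewrite [LHS](conormal_expand Fc cx (f0 _ (cU _ cx))); apply: eq_bigr => i _.
rewrite covec_comp_pair; congr (_ *: _).
exact: svalP (cid (fac i)) x cx.
Qed.

End Leaves.

(** * Algebra of bivectors *)

Section Bivectors.
Context {R : realType} {n : nat} {M : manifold R n}.
Implicit Type x : M.

Lemma bipairDl x (W : bivector x) (a b k : cotangent x) :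
  bipair W (a + b : cotangent x) k = bipair W a k + bipair W b k.
Proof. by rewrite /bipair linearD /= !mulmxDl mxE. Qed.

Lemma bipairZl x (W : bivector x) (r : R) (a k : cotangent x) :
  bipair W (r *: a : cotangent x) k = r * bipair W a k.
Proof. by rewrite /bipair linearZ /= -!scalemxAl mxE. Qed.

Lemma bipairDr x (W : bivector x) (a b k : cotangent x) :
  bipair W k (a + b : cotangent x) = bipair W k a + bipair W k b.
Proof. by rewrite /bipair mulmxDr mxE. Qed.

Lemma bipairZr x (W : bivector x) (r : R) (a k : cotangent x) :
  bipair W k (r *: a : cotangent x) = r * bipair W k a.
Proof. by rewrite /bipair -scalemxAr mxE. Qed.

Lemma bipair_suml x (W : bivector x) m (a : 'I_m -> cotangent x)
    (k : cotangent x) :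
  bipair W (\sum_(i < m) a i : cotangent x) k = \sum_(i < m) bipair W (a i) k.
Proof. by rewrite /bipair linear_sum /= !mulmx_suml summxE. Qed.

Lemma bipair_wedge x (v w : tangent x) (a b : cotangent x) :
  bipair (wedge v w) a b = pair a v * pair b w - pair a w * pair b v.
Proof.
have E (v' w' : tangent x) :
    (a^T *m (v'^T *m w') *m b) 0 0 = pair a v' * pair b w'.
  rewrite mulmxA -mulmxA -trmx_mul mxE big_ord1 mxE.
  by [].
by rewrite /bipair /wedge mulmxBr mulmxBl mxE [X in _ + X]mxE !E.
Qed.

Lemma bipairZ x (W : bivector x) (r : R) (a b : cotangent x) :
  bipair (r *: W : bivector x) a b = r * bipair W a b.
Proof. by rewrite /bipair -scalemxAr -scalemxAl mxE. Qed.

Lemma bipair_sum x m (W : 'I_m -> bivector x) (a b : cotangent x) :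
  bipair (\sum_(i < m) W i : bivector x) a b = \sum_(i < m) bipair (W i) a b.
Proof. by rewrite /bipair mulmx_sumr mulmx_suml summxE. Qed.

End Bivectors.

(** * Skew-symmetric morphisms and their bivectors *)

Section SkewMorphism.
Context {R : realType} {q p : nat} {M : manifold R (q + p)}.
Variables (F : foliation M) (h : fibre_map M).
Hypotheses (h_morphism : bundle_morphism F h) (h_skew : skew_symmetric F h).

Lemma morphism_sum x m (r : 'I_m -> R) (a : 'I_m -> cotangent x) :
  (forall i, conormal F (a i)) ->
  h (\sum_(i < m) r i *: a i : cotangent x) = \sum_(i < m) r i *: h (a i).
Proof.
move=> a0; have hl := h_morphism.1 x.
have c0 : conormal F (0 : cotangent x).
  by move=> v _; rewrite /pair mulmx0 mxE.
elim: m r a a0 => [|m IH] r a a0.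
  (* Linearity at r = 1, a = b = 0 reads h 0 = h 0 + h 0, hence h 0 = 0. *)
  rewrite !big_ord0; have := hl 1 0 0 c0 c0.
  rewrite scaler0 addr0 scale1r => /eqP; rewrite -subr_eq0 opprD addrA subrr.
  by rewrite add0r oppr_eq0 => /eqP.
rewrite !big_ord_recl hl // ?IH //; apply: conormal_sum => i.
exact: conormalZ.
Qed.

Lemma morphism_smooth U (a : one_form M) : open U -> foliated_one_form F U a ->
  smooth_vector_field U (fun x => h (a x)).
Proof.
move=> oU fa; apply: h_morphism.2 => //; first exact: fa.1.
by move=> x; exact: foliated_one_form_conormal.
Qed.

Lemma smooth_pair_morphism U (a b : one_form M) : open U ->
  foliated_one_form F U a -> smooth_one_form U b ->
  smooth_fun U (fun x => pair (b x) (h (a x))).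
Proof. by move=> oU fa sb; apply: smooth_pair => //;
  exact: morphism_smooth. Qed.

(** Conormal covectors kill vertical vectors, hence the corrections [t] of the frame and the part
    [k] of [h]: only [w] contributes. The factor 2^-1 compensates for each wedge occurring twice in
    the sum over all pairs. *)
Lemma local_bivectorE (c : chart R (q + p) M) (x : M) (t k : 'M[R]_(q, p))
    (w : 'M[R]_q) (B : bivector x) (a b : cotangent x) :
  adapted F c -> dom c x ->
  (forall i : 'I_q, h (coord_covec c (lshift p i) x) =
     \sum_(j < q) w i j *: frame_vec c t j x
     + \sum_(u < p) k i u *: coord_vec c (rshift q u) x) ->
  B = 2^-1 *: \sum_(i < q) \sum_(j < q) w i j *:
        wedge (frame_vec c t i x) (frame_vec c t j x) ->
  conormal F a -> conormal F b -> bipair B a b = pair b (h a).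
Proof.
move=> Fc cx hE BE a0 b0.
have vert (d : cotangent x) (r : 'I_p -> R) : conormal F d ->
    pair d (\sum_(u < p) r u *: coord_vec c (rshift q u) x : tangent x) = 0.
  move=> d0; rewrite pair_sumr big1 // => u _.
  by rewrite pairZr d0 ?mulr0 //; exact: coord_vec_TF.
have frameE (d : cotangent x) i : conormal F d ->
    pair d (frame_vec c t i x) = covec_comp c d (lshift p i) 0.
  move=> d0; rewrite /frame_vec pairDr -scaleN1r pairZr vert // mulr0 addr0.
  by rewrite covec_comp_pair.
have S (d e : cotangent x) : conormal F d -> conormal F e -> pair e (h d) =
    \sum_(i < q) \sum_(j < q) w i j *
      (pair d (frame_vec c t i x) * pair e (frame_vec c t j x)).
  move=> d0 e0; rewrite {1}(conormal_expand Fc cx d0) morphism_sum; last first.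
    by move=> i; exact: conormal_coord.
  rewrite pair_sumr; apply: eq_bigr => i _.
  rewrite pairZr hE pairDr vert // addr0 pair_sumr mulr_sumr.
  apply: eq_bigr => j _; rewrite pairZr (frameE d) //; ring.
(* The wedges antisymmetrise [h]; its skew symmetry then makes the two halves equal. *)
have T : bipair B a b = 2^-1 * (pair b (h a) - pair a (h b)).
  rewrite (S a b) // (S b a) // BE bipairZ bipair_sum -sumrB; congr (_ * _).
  apply: eq_bigr => i _; rewrite bipair_sum -sumrB; apply: eq_bigr => j _.
  by rewrite bipairZ bipair_wedge; ring.
by rewrite T (h_skew a0 b0); field.
Qed.

End SkewMorphism.

(** * The cyclic sum as an algebraic identity *)

Section JacobiSum.
Context {R : comPzRingType} {q : nat}.

Lemma sum_rot (f : 'I_q -> 'I_q -> 'I_q -> R) :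
  \sum_i \sum_j \sum_k f i j k = \sum_i \sum_j \sum_k f j k i.
Proof.
rewrite exchange_big [RHS]exchange_big /=.
under [RHS]eq_bigr => j _ do rewrite exchange_big /=.
rewrite [LHS]exchange_big /=.
by [].
Qed.

(* With D i the derivation H(dx^i) and w i j = {x^i, x^j}, schouten_term is
   <c, H(L_(Ha) b)> for 1-forms with coefficients a, b, c, whose derivatives
   along D are da, db. *)
Definition schouten_term (w : 'I_q -> 'I_q -> R) (dw : 'I_q -> 'I_q -> 'I_q ->
  R)
    (a b c : 'I_q -> R) (da db : 'I_q -> 'I_q -> R) : R :=
  \sum_i \sum_j \sum_k (a i * c k * w k j * db j i
    + b j * c k * w i j * da i k + a i * b j * c k * dw i j k).

(** Rotating the indices of the second and third sums aligns the coefficients. Each derivative of a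
    coefficient then occurs twice, with an entry of w and the transposed entry, and cancels; a_i b_j
    c_k times a Jacobi sum remains. *)
Lemma schouten_term_cyclic w dw a b c da db dc :
  (forall i j, w i j = - w j i) ->
  (forall i j k, dw i j k + dw j k i + dw k i j = 0) ->
  schouten_term w dw a b c da db + schouten_term w dw b c a db dc
  + schouten_term w dw c a b dc da = 0.
Proof.
move=> wN dw0; rewrite /schouten_term [X in _ + X + _]sum_rot.
rewrite [X in _ + X]sum_rot [X in _ + X]sum_rot -!big_split big1 //= => i _.
rewrite -!big_split big1 //= => j _; rewrite -!big_split big1 //= => k _.
(* The target 0 is replaced by the Jacobi term; the skew relations then leave an identity for
   [ring]. *)
have <- : a i * b j * c k * (dw i j k + dw j k i + dw k i j) = 0.
  by rewrite dw0 mulr0.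
by rewrite (wN k j) (wN i k) (wN j i); ring.
Qed.

End JacobiSum.

(** * Hamiltonian structures and Poisson brackets *)

Section Equivalence.
Context {R : realType} {q p : nat} {M : manifold R (q + p)}.
Variables (F : foliation M) (h : fibre_map M) (W : bivector_field M).
Hypotheses (h_morphism : bundle_morphism F h) (h_skew : skew_symmetric F h).
Hypothesis W_h : forall (x : M) (a b : cotangent x),
  conormal F a -> conormal F b -> bipair (W x) a b = pair b (h a).
Implicit Types (c : chart R (q + p) M) (x : M) (U : set M) (f g k : M -> R).

Lemma foliated_dfun_conormal U f x : open U -> foliated_fun F U f -> U x ->
  conormal F (dfun f x).
Proof. by move=> oU /(foliated_funP _ _ oU)[_]; exact. Qed.

Lemma bracketE U f g x : open U -> foliated_fun F U f -> foliated_fun F U g ->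
  U x -> bracket W f g x = pair (dfun g x) (h (dfun f x)).
Proof.
by move=> oU ff fg Ux; apply: W_h; exact: foliated_dfun_conormal Ux.
Qed.

Lemma smooth_bracket U f g : open U -> foliated_fun F U f ->
  foliated_fun F U g -> smooth_fun U (bracket W f g).
Proof.
move=> oU ff fg; apply: (smooth_fun_eq oU _ (smooth_pair_morphism h_morphism oU
  (foliated_dfun oU ff) (smooth_dfun oU fg.1))).
by move=> x Ux; rewrite (bracketE oU ff fg Ux).
Qed.

Lemma bracket_leibniz U f g k x : open U -> foliated_fun F U f ->
  foliated_fun F U g -> U x ->
  bracket W (fun y => f y * g y) k x = f x * bracket W g k x + bracket W f k x
    * g x
  /\ bracket W k (fun y => f y * g y) x
     = f x * bracket W k g x + bracket W k f x * g x.
Proof.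
move=> oU ff fg Ux; rewrite /bracket dfunM; last 2 first.
- exact: smooth_diff_at ff.1 Ux.
- exact: smooth_diff_at fg.1 Ux.
rewrite bipairDl !bipairZl bipairDr !bipairZr.
by split; rewrite addrC [_ * g x]mulrC.
Qed.

Lemma bracket_linear U f g k (r : R) x : open U -> foliated_fun F U f ->
  foliated_fun F U g -> U x ->
  bracket W (fun y => r * f y + g y) k x = r * bracket W f k x + bracket W g k x
  /\ bracket W k (fun y => r * f y + g y) x
     = r * bracket W k f x + bracket W k g x.
Proof.
move=> oU ff fg Ux.
have df := smooth_diff_at ff.1 Ux; have dg := smooth_diff_at fg.1 Ux.
have dr : diff_at (fun=> r : R) x by exact: differentiable_cst.
have drf : diff_at (fun y => r * f y) x.
  exact: smooth_diff_at (smooth_funM oU (smooth_fun_cst U r) ff.1) Ux.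
rewrite /bracket (dfunD drf dg) (dfunM dr df) dfun_cst scaler0 add0r.
by rewrite bipairDl bipairZl bipairDr bipairZr.
Qed.

Lemma bracketxx U f x : open U -> foliated_fun F U f -> U x ->
  bracket W f f x = 0.
Proof.
move=> oU ff Ux; have f0 := foliated_dfun_conormal oU ff Ux.
have := h_skew f0 f0; rewrite (bracketE oU ff ff Ux) => E.
by apply/eqP; rewrite -[_ == _](mulrn_eq0 _ 2) mulr2n {1}E addNr.
Qed.

(** * From hamiltonian structures to Poisson brackets *)

Section Necessity.
Hypothesis H : hamiltonian_structure F h.

(** The test fields Y are the vertical coordinate fields, available on an adapted chart: the
    hypothesis is applied over [dom c]. There dg kills both Y and the tangent field [X, Y]. *)
Lemma foliated_bracket U f g : open U -> foliated_fun F U f ->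
  foliated_fun F U g -> foliated_fun F U (bracket W f g).
Proof.
move=> oU ff fg; apply/foliated_funP => //; split; first exact: smooth_bracket.
move=> x Ux; have [c [Fc cU cx]] := adapted_restrict F oU Ux.
have ac := adapted_atlas Fc; have oc := @dom_open _ _ _ c.
have [sf f0] := (foliated_funP _ _ oU).1 ff;
  have [sg g0] := (foliated_funP _ _ oU).1 fg.
have ffc : foliated_fun F (dom c) f.
  by apply/foliated_funP => //; split=> [|y /cU];
    [exact: smooth_fun_mono sf|exact: f0].
have sgc := smooth_fun_mono cU sg.
have [_ /(_ _ (foliated_dfun oc ffc))[sX fX] _ _ _] := H.2 _ oc.
set X := fun y => _ in sX fX.
apply: (conormal_chart Fc cx) => u.
have sY : smooth_vector_field (dom c) (coord_vec c (rshift q u)).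
  exact: smooth_coord_vec.
have tY y : dom c y -> in_TF F (coord_vec c (rshift q u) y).
  exact: coord_vec_TF.
have [_ /(_ x cx)/(g0 _ Ux)] := fX _ (conj sY tY).
rewrite (lie_bracketE oc cx sgc sX sY).
(* Yg = 0 on the whole domain, hence X(Yg) = 0; what is left is Y{f, g} = 0. *)
rewrite (@dfun_eq _ _ _ _ (fun y => pair (dfun g y) (coord_vec c (rshift q u)
  y))
  (fun=> 0) x oc cx); last by move=> y cy; apply: g0; [exact: cU|exact: tY].
rewrite dfun_cst {1}/pair mulmx0 mxE add0r => /eqP; rewrite oppr_eq0 => /eqP.
rewrite (@dfun_eq _ _ _ _ (bracket W f g) (fun y => pair (dfun g y) (X y)) x oc
  cx) //.
by move=> y /cU; exact: bracketE.
Qed.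

(** The case of one summand with coefficient 1 in [lie_derivativeE]. *)
Lemma lie_derivative_dfun U f (X : vector_field M) x : open U -> U x ->
  smooth_fun U f -> smooth_vector_field U X ->
  lie_derivative X (dfun f) x = dfun (fun y => pair (dfun f y) (X y)) x.
Proof.
move=> oU Ux sf sX.
rewrite (@lie_derivativeE _ _ _ U 1 (fun _ _ => 1) (fun _ => f) X) //.
- by rewrite big_ord1 dfun_cst {1}/pair mulmx0 mxE scale0r add0r scale1r.
- by move=> _; exact: smooth_fun_cst.
- by move=> y _; rewrite big_ord1 scale1r.
Qed.

(** For X = H(df), L_X dg = d{f, g}: each term of [H, H] on exact forms is an iterated bracket.
    Expressing the outer bracket with [h] requires {f, g} to be foliated. *)
Lemma bracket_jacobi U f g k x : open U -> foliated_fun F U f ->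
  foliated_fun F U g -> foliated_fun F U k -> U x ->
  bracket W (bracket W f g) k x + bracket W (bracket W g k) f x
  + bracket W (bracket W k f) g x = 0.
Proof.
move=> oU ff fg fk Ux; have [_ _ _ _ S] := H.2 _ oU.
have term f1 g1 k1 : foliated_fun F U f1 -> foliated_fun F U g1 ->
    foliated_fun F U k1 -> bracket W (bracket W f1 g1) k1 x =
    pair (dfun k1 x) (h (lie_derivative (fun y => h (dfun f1 y)) (dfun g1) x)).
  move=> ff1 fg1 fk1.
  rewrite (bracketE oU (foliated_bracket oU ff1 fg1) fk1 Ux).
  rewrite (lie_derivative_dfun oU Ux fg1.1); last first.
    exact: morphism_smooth (foliated_dfun oU ff1).
  rewrite (@dfun_eq _ _ _ U (bracket W f1 g1)
    (fun y => pair (dfun g1 y) (h (dfun f1 y)))) // => y.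
  exact: bracketE.
rewrite (term f g k) // (term g k f) // (term k f g) //.
have := S _ _ _ (foliated_dfun oU ff) (foliated_dfun oU fg) (foliated_dfun oU
  fk) x Ux.
by rewrite /schouten => /eqP; rewrite mulf_eq0 pnatr_eq0 /= => /eqP.
Qed.

Lemma hamiltonian_poisson : defines_poisson_algebra F W.
Proof.
move=> U oU f g k ff fg fk; split; first exact: foliated_bracket.
move=> x Ux; split.
- by move=> r; have [] := bracket_linear k r oU ff fg Ux.
- by move=> r; have [] := bracket_linear k r oU ff fg Ux.
- exact: bracketxx Ux.
- exact: bracket_jacobi Ux.
- exact: bracket_leibniz Ux.
Qed.

(** The components of W in an adapted chart are the brackets of the x^i, constant on plaques by
    [foliated_bracket]. *)
Lemma hamiltonian_foliated : foliated_bivector F W.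
Proof.
move=> c Fc; have oc := @dom_open _ _ _ c.
pose w y : 'M[R]_q := \matrix_(i, j)
  bracket W (fun y => coord c y 0 (lshift p i)) (fun y => coord c y 0 (lshift p
    j)) y.
have [|v vE] := @factor_tcoord _ _ _ _ ('M[R]_q) 0 c w; last first.
  by exists v => x cx i j; rewrite -vE // mxE.
move=> x y cx cy xy; apply/matrixP => i j; rewrite !mxE.
have fb := foliated_bracket oc (foliated_coord i Fc) (foliated_coord j Fc).
apply: fb.2 => //; apply: Relation_Operators.rst_step; exists c.
by split=> //; exact: subset_refl.
Qed.

End Necessity.

(** * From Poisson brackets to hamiltonian structures *)

Section Sufficiency.
Hypotheses (W_foliated : foliated_bivector F W)
  (W_poisson : defines_poisson_algebra F W).

(** With a = a_j dx^j, the function <dx^i, H a> is a_j w^{ji}, where both factors depend on the x^a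
    alone since W is foliated. *)
Lemma coord_morphism_conormal U (a : one_form M) c (i : 'I_q) x : open U ->
  foliated_one_form F U a -> adapted F c -> dom c `<=` U -> dom c x ->
  conormal F (dfun (fun y => pair (coord_covec c (lshift p i) y) (h (a y))) x).
Proof.
move=> oU fa Fc cU cx; have oc := @dom_open _ _ _ c.
have [_ /(_ c Fc cU)[g gE]] := fa; have [w wE] := W_foliated Fc.
have fac := foliated_one_form_mono cU fa.
move: x cx; apply: (plaque_constP Fc _).1.
  apply: (smooth_pair_morphism h_morphism) => //; apply: smooth_dfun => //.
  exact: smooth_coord (adapted_atlas Fc).
have E y : dom c y -> pair (coord_covec c (lshift p i) y) (h (a y)) =
    \sum_(j < q) g j (tcoord c y) * w (tcoord c y) j i.
  move=> cy; have y0 := foliated_one_form_conormal oc fac cy.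
  rewrite -(W_h y0 (conormal_coord i Fc cy)) gE // bipair_suml.
  by apply: eq_bigr => j _; rewrite bipairZl wE.
by move=> y z cy cz yz; rewrite !E // yz.
Qed.

(** As Y x^i = 0, the transverse components of [H a, Y] are - Y<dx^i, H a>, which vanish by
    [coord_morphism_conormal]. *)
Lemma foliated_field_morphism U (a : one_form M) : open U ->
  foliated_one_form F U a -> foliated_field F U (fun x => h (a x)).
Proof.
move=> oU fa; have sX := morphism_smooth h_morphism oU fa.
split=> // Y [sY tY]; split; first exact: smooth_lie_bracket.
move=> x Ux; have [c [Fc cU cx]] := adapted_restrict F oU Ux.
have ac := adapted_atlas Fc; have oc := @dom_open _ _ _ c.
apply: (in_TF_chart Fc cx); apply/rowP => i; rewrite mxE [RHS]mxE.
rewrite vec_comp_pair // (lie_bracketE oc cx (smooth_coord _ ac)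
  (smooth_vector_field_mono cU sX) (smooth_vector_field_mono cU sY)).
rewrite (@dfun_eq _ _ _ _ (fun y => pair (coord_covec c (lshift p i) y) (Y y))
  (fun=> 0) x oc cx); last first.
  by move=> y cy; apply: conormal_coord Fc cy _ (tY _ (cU _ cy)).
rewrite dfun_cst {1}/pair mulmx0 mxE add0r.
by rewrite (coord_morphism_conormal i oU fa Fc cU cx) ?oppr0 //; exact: tY.
Qed.

(** The Lie derivative is expanded with b = b_j dx^j, and d<dx^j, H a> by the Leibniz rule. The
    minus sign comes from moving [h] onto [g], which requires the Lie derivative to be conormal. *)
Lemma schouten_coord U (a b g : one_form M) c x : open U ->
  foliated_one_form F U a -> foliated_one_form F U b ->
  foliated_one_form F U g -> adapted F c -> dom c `<=` U -> dom c x ->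
  let D f l := pair (dfun f x) (h (coord_covec c (lshift p l) x)) in
  let w i j y := pair (coord_covec c (lshift p j) y)
                   (h (coord_covec c (lshift p i) y)) in
  let coef (e : one_form M) i y := covec_comp c (e y) (lshift p i) 0 in
  pair (g x) (h (lie_derivative (fun y => h (a y)) b x)) =
  - schouten_term (fun i j => w i j x) (fun i j => D (w i j))
      (coef a ^~ x) (coef b ^~ x) (coef g ^~ x)
      (fun i => D (coef a i)) (fun i => D (coef b i)).
Proof.
move=> oU fa fb fg Fc cU cx D w coef.
have ac := adapted_atlas Fc; have oc := @dom_open _ _ _ c.
have c0 e y : foliated_one_form F U e -> dom c y -> conormal F (e y).
  by move=> fe /cU; exact: foliated_one_form_conormal.
have coefE e y : foliated_one_form F U e -> dom c y ->
    e y = \sum_(i < q) coef e i y *: coord_covec c (lshift p i) y.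
  by move=> fe cy; exact: conormal_expand Fc cy (c0 _ _ fe cy).
have s_coef e i : foliated_one_form F U e -> smooth_fun (dom c) (coef e i).
  move=> fe; apply: (smooth_fun_eq oc (f := fun y =>
    pair (e y) (coord_vec c (lshift p i) y))).
    by move=> y _; rewrite /coef covec_comp_pair.
  apply: smooth_pair => //; last exact: smooth_coord_vec.
  exact: (foliated_one_form_mono cU fe).1.
have f_coord i : foliated_one_form F (dom c) (coord_covec c (lshift p i)).
  exact: foliated_dfun (foliated_coord i Fc).
have s_w i j : smooth_fun (dom c) (w i j).
  by apply: (smooth_pair_morphism h_morphism) => //; exact: (f_coord j).1.
have hE e y : foliated_one_form F U e -> dom c y ->
    h (e y) = \sum_(i < q) coef e i y *: h (coord_covec c (lshift p i) y).
  move=> fe cy; rewrite [in LHS](coefE _ _ fe cy) (morphism_sum h_morphism) //.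
  by move=> i; exact: conormal_coord.
have DE f e : foliated_one_form F U e ->
    pair (dfun f x) (h (e x)) = \sum_(l < q) coef e l x * D f l.
  move=> fe; rewrite (hE _ _ fe cx) pair_sumr.
  by apply: eq_bigr => l _; rewrite pairZr.
pose u j y := pair (coord_covec c (lshift p j) y) (h (a y)).
(* Here W foliated makes the terms d<dx^j, H a> of the Lie derivative conormal. *)
have u0 j : conormal F (dfun (u j) x) by exact: coord_morphism_conormal fa _ cU
  _.
have du j : dfun (u j) x = \sum_(i < q) (w i j x *: dfun (coef a i) x
    + coef a i x *: dfun (w i j) x) :> cotangent x.
  rewrite (@dfun_eq _ _ _ _ _ (fun y => \sum_(i < q) coef a i y * w i j y) x oc
    cx).
    rewrite dfun_sum => [|i].
      apply: eq_bigr => i _; rewrite dfunM //; last exact: smooth_diff_at cx.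
      exact: smooth_diff_at (s_coef _ i fa) cx.
    exact: smooth_diff_at (smooth_funM oc (s_coef _ i fa) (s_w i j)) cx.
  move=> y cy; rewrite /u (hE _ _ fa cy) pair_sumr.
  by apply: eq_bigr => i _; rewrite pairZr.
rewrite (@lie_derivativeE _ _ _ _ _ (coef b) (fun j y => coord c y 0 (lshift p
  j))
  (fun y => h (a y)) b x oc cx); last 4 first.
- by move=> j; exact: s_coef.
- by move=> j; exact: smooth_coord.
- have sX := morphism_smooth h_morphism oc (foliated_one_form_mono cU fa).
  exact: sX.
- by move=> y; exact: coefE.
rewrite h_skew; [|exact: c0|].
  (* The index j of b becomes the outermost one, as in the expansion of the Lie derivative. *)
  congr (- _); rewrite pair_suml /schouten_term [RHS]exchange_big /=.
  apply: eq_bigr => j _; rewrite pairDl !pairZl.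
  rewrite (DE _ _ fa) -/(u j) du pair_suml.
  have -> : pair (coord_covec c (lshift p j) x) (h (g x)) =
      \sum_(l < q) coef g l x * w l j x.
    by rewrite (hE _ _ fg cx) pair_sumr; apply: eq_bigr => l _; rewrite pairZr.
  rewrite mulr_suml mulr_sumr -big_split /=; apply: eq_bigr => i _.
  rewrite pairDl !pairZl !(DE _ _ fg) mulr_sumr mulrDr !mulr_sumr -!big_split
    /=.
  by apply: eq_bigr => l _; ring.
apply: conormal_sum => j; apply: conormalD; apply: conormalZ; last exact: u0.
exact: conormal_coord.
Qed.

Lemma poisson_schouten U (a b g : one_form M) x : open U ->
  foliated_one_form F U a -> foliated_one_form F U b ->
  foliated_one_form F U g -> U x ->
  schouten (fun e y => h (e y)) a b g x = 0.
Proof.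
move=> oU fa fb fg Ux; have [c [Fc cU cx]] := adapted_restrict F oU Ux.
have oc := @dom_open _ _ _ c.
rewrite /schouten (schouten_coord oU fa fb fg Fc cU cx).
rewrite (schouten_coord oU fb fg fa Fc cU cx).
rewrite (schouten_coord oU fg fa fb Fc cU cx) -!opprD.
pose X (i : 'I_q) y := coord c y 0 (lshift p i).
have fX i : foliated_fun F (dom c) (X i) by exact: foliated_coord.
have wE i j y : dom c y -> pair (coord_covec c (lshift p j) y)
    (h (coord_covec c (lshift p i) y)) = bracket W (X i) (X j) y.
  by move=> cy; rewrite (bracketE oc (fX i) (fX j) cy).
rewrite schouten_term_cyclic ?oppr0 ?mulr0 // => [i j|i j l].
  by rewrite h_skew //; exact: conormal_coord.
(* The derivative of {x^m', x^m} along H(dx^r) is minus an iterated bracket: skew symmetry applies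
   because {x^m', x^m} is foliated, so that its differential is conormal. *)
have DE m m' r : pair (dfun (fun y => pair (coord_covec c (lshift p m) y)
    (h (coord_covec c (lshift p m') y))) x) (h (coord_covec c (lshift p r) x)) =
    - bracket W (bracket W (X m') (X m)) (X r) x.
  have [fb' _] := W_poisson oc (fX m') (fX m) (fX r).
  have -> := @dfun_eq _ _ _ _ _ (bracket W (X m') (X m)) x oc cx (wE m' m).
  rewrite (bracketE oc fb' (fX r) cx); apply: h_skew.
    exact: foliated_dfun_conormal oc fb' cx.
  exact: conormal_coord.
apply: (etrans (congr2 +%R (congr2 +%R (DE j i l) (DE l j i)) (DE i l j))).
have [_ /(_ x cx)[_ _ _ J _]] := W_poisson oc (fX i) (fX j) (fX l).
have oppr3 (r s t : R) : - r + - s + - t = - (r + s + t) by ring.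
by rewrite oppr3 J oppr0.
Qed.

Lemma poisson_hamiltonian : hamiltonian_structure F h.
Proof.
split=> // U oU; split.
- by move=> a b fa fb ab x Ux; rewrite ab.
- by move=> a; exact: foliated_field_morphism.
- move=> r a b fa fb x Ux; apply: h_morphism.1;
  exact: foliated_one_form_conormal Ux.
- by move=> a b fa fb x Ux; apply: h_skew; exact: foliated_one_form_conormal Ux.
- by move=> a b g fa fb fg x Ux; exact: poisson_schouten Ux.
Qed.

End Sufficiency.
End Equivalence.

Theorem proposition2p1 (R : realType) (q p : nat) (M : manifold R (q + p))
    (F : foliation M)
    (E : forall x : M, {vspace 'rV[R]_(q + p)}) (hE : complement F E)
    (h : fibre_map M) (h_morphism : bundle_morphism F h)
    (h_skew : skew_symmetric F h)
    (t k : chart R (q + p) M -> M -> 'M[R]_(q, p))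
    (hab : chart R (q + p) M -> M -> 'M[R]_q)
    (hX : forall c x, adapted F c -> dom c x ->
       forall a : 'I_q, frame_vec c (t c x) a x \in E x)
    (h_local : forall c x, adapted F c -> dom c x -> forall a : 'I_q,
       h x (coord_covec c (lshift p a) x) =
         \sum_(b < q) hab c x a b *: frame_vec c (t c x) b x
         + \sum_(u < p) k c x a u *: coord_vec c (rshift q u) x)
    (W : bivector_field M)
    (hW : forall c x, adapted F c -> dom c x ->
       W x = 2^-1 *: \sum_(a < q) \sum_(b < q) hab c x a b *:
         wedge (frame_vec c (t c x) a x) (frame_vec c (t c x) b x)) :
  hamiltonian_structure F h <->
  (foliated_bivector F W /\ defines_poisson_algebra F W).
Proof.
have W_h (x : M) (a b : cotangent x) : conormal F a -> conormal F b ->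
    bipair (W x) a b = pair b (h x a).
  (* The identity is pointwise, so any adapted chart around [x] will do. *)
  have [c Fc cx] := adapted_cover F x.
  exact: (@local_bivectorE _ _ _ _ _ _ h_morphism h_skew c x (t c x) (k c x)
    (hab c x) (W x) a b Fc cx (h_local c x Fc cx) (hW c x Fc cx)).
split=> [H|[Wf Wp]]; last exact: poisson_hamiltonian W_h Wf Wp.
split; first exact: (hamiltonian_foliated h_morphism W_h H).
exact: (hamiltonian_poisson h_morphism h_skew W_h H).
Qed.
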